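(* Let $q\ge2$ be an integer. The spectrum of the simple random walk operator $P$ on $\ell^2(\mathrm{DL}(q,q,q))$ is the interval $\left[-\tfrac12,1\right]$. It is the closure of the set of eigenvalues $$\{\lambda_{\mathbf m,N}: N\ge2,\ \mathbf m=(m_1,m_2,m_3)\in\mathbb A_2\text{ with }m_1,m_2>0,\ m_3>-N\},$$ where $$\lambda_{\mathbf m,N}=\frac13\left(\cos\Bigl(\frac{2\pi(m_1-m_2)}{3N}\Bigr)+\cos\Bigl(\frac{2\pi(m_2-m_3)}{3N}\Bigr)+\cos\Bigl(\frac{2\pi(m_3-m_1)}{3N}\Bigr)\right).$$
   Context: $\mathbb A_2=\{\mathbf m\in\mathbb Z^3:m_1+m_2+m_3=0\}$. $\mathbb T_q$ is the homogeneous tree in which every vertex has $q+1$ neighbours, with graph metric $d(\cdot,\cdot)$, a fixed origin $o$ and a fixed end $\omega$ (an end is a class of one-sided infinite geodesic rays, two rays being equivalent if their symmetric difference is finite). Let $x\curlywedge y$ be the maximal common ancestor of $x,y$, i.e. the first common vertex of the geodesic rays from $x$ and from $y$ that represent $\omega$. The Busemann function is $\mathfrak h(x)=d(x,x\curlywedge o)-d(o,x\curlywedge o)$. The graph $\mathrm{DL}(q,q,q)$ has vertex set $\{x_1x_2x_3\in(\mathbb T_q)^3:\ \mathfrak h(x_1)+\mathfrak h(x_2)+\mathfrak h(x_3)=0\}$, and $x_1x_2x_3$, $y_1y_2y_3$ are neighbours iff there are $i\ne j$ such that $x_i\sim y_i$, $x_j\sim y_j$ in $\mathbb T_q$ and $x_k=y_k$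 for the remaining index $k$. It is regular of degree $6q$, and $Pf(x)=\frac1{6q}\sum_{y\sim x}f(y)$ on the space $\ell^2(\mathrm{DL}(q,q,q))$ of complex square-summable functions. *)

(* Defs.v *)
From mathcomp Require Import all_boot all_order all_algebra.
From mathcomp Require Import all_classical all_reals all_analysis.
From mathcomp Require Import complex.

Set Implicit Arguments.
Unset Strict Implicit.
Unset Printing Implicit Defensive.

Import Order.TTheory GRing.Theory Num.Theory.
Import numFieldNormedType.Exports.

Local Open Scope classical_set_scope.
Local Open Scope ring_scope.

Section Tree.
Variables (T : choiceType) (e : rel T).

(* Connected, without cycles, every vertex having exactly [q.+1] neighbours.
   [ucycle e [:: x; y]] holds for every edge, so only cycles of length at
   least 3 are excluded. *)
Record homogeneous_tree (q : nat) : Prop := HomogeneousTree {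
  tree_sym : symmetric e;
  tree_irr : irreflexive e;
  tree_connected : forall x y, exists2 p, path e x p & last x p = y;
  tree_acyclic : forall c, ucycle e c -> (size c <= 2)%N;
  tree_regular : forall x, exists s : seq T,
    [/\ uniq s, size s = q.+1 & forall y, (y \in s) = e x y] }.

(* [0] by default if [x] and [y] are not connected. *)
Definition gdist (x y : T) : nat :=
  xget 0%N [set n |
    (exists p, [/\ path e x p, last x p = y & size p = n]) /\
    (forall p, path e x p -> last x p = y -> (n <= size p)%N)].

Definition geodesic_ray (r : nat -> T) : Prop :=
  forall m n, (m <= n)%N -> gdist (r m) (r n) = (n - m)%N.

Definition equiv_ray (r s : nat -> T) : Prop :=
  finite_set ((range r `\` range s) `|` (range s `\` range r)).

Definition is_end (omega : set (nat -> T)) : Prop :=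
  exists2 r, geodesic_ray r &
    omega = [set s | geodesic_ray s /\ equiv_ray r s].

Variables (omega : set (nat -> T)) (o : T).

(* In a tree there is exactly one ray of [omega] starting at [x]; the default
   value is never used. *)
Definition ray_from (x : T) : nat -> T :=
  xget (fun=> x) [set r | omega r /\ r 0%N = x].

Definition common_ancestor (x y : T) : T :=
  xget x [set v | exists n,
    [/\ v = ray_from x n, range (ray_from y) v &
        forall m, (m < n)%N -> ~ range (ray_from y) (ray_from x m)]].

Definition busemann (x : T) : int :=
  (gdist x (common_ancestor x o))%:Z - (gdist o (common_ancestor x o))%:Z.

Definition DL : choiceType :=
  {x : {ffun 'I_3 -> T} | \sum_(i < 3) busemann (x i) == 0}.

Definition DL_adj (x y : DL) : Prop :=
  exists i j : 'I_3, [/\ i != j, e (val x i) (val y i), e (val x j) (val y j) &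
    forall k, k != i -> k != j -> val x k = val y k].

(* [\sum_(y \in A)] is the sum over a set [A] containing finitely many points
   where the summand is nonzero; here [A] has [6 * q] elements. *)
Definition srw (R : realType) (q : nat) (f : DL -> R[i]) (x : DL) : R[i] :=
  (6 * q)%:R^-1 * \sum_(y \in [set y | DL_adj x y]) f y.

End Tree.

Section EllTwo.
Variables (R : realType) (V : choiceType).
Implicit Types (f g : V -> R[i]) (A B : (V -> R[i]) -> (V -> R[i])).

Definition l2 : set (V -> R[i]) :=
  [set f | summable setT (fun x => (Normc.normc (f x) ^+ 2)%:E)].

Definition l2norm f : R :=
  Num.sqrt (fine (\esum_(x in setT) (Normc.normc (f x) ^+ 2)%:E)).

Definition bounded_on_l2 B : Prop :=
  [/\ forall f, l2 f -> l2 (B f),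
      forall (a : R[i]) f g, l2 f -> l2 g ->
        B (fun x => a * f x + g x) = (fun x => a * B f x + B g x) &
      exists C : R, forall f, l2 f -> l2norm (B f) <= C * l2norm f].

(* Operators are given on all functions, but only their restriction to [l2]
   matters. *)
Definition spectrum A : set R[i] :=
  [set z | ~ exists2 B, bounded_on_l2 B & forall f, l2 f ->
      B (fun x => A f x - z * f x) = f /\
      (fun x => A (B f) x - z * B f x) = f].

Definition eigenvalues A : set R[i] :=
  [set z | exists f, [/\ l2 f, f <> (fun=> 0) & A f = (fun x => z * f x)]].

End EllTwo.

Definition lambda_mN (R : realType) (m1 m2 m3 : int) (N : nat) : R :=
  3^-1 * (cos (2 * pi * (m1 - m2)%:~R / (3 * N%:R))
        + cos (2 * pi * (m2 - m3)%:~R / (3 * N%:R))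
        + cos (2 * pi * (m3 - m1)%:~R / (3 * N%:R))).

Definition lambda_set (R : realType) : set R[i] :=
  [set z | exists m1 m2 m3 : int, exists N : nat,
    [/\ (2 <= N)%N, m1 + m2 + m3 = 0, (0 < m1) && (0 < m2), - (N%:Z) < m3 &
        z = (lambda_mN R m1 m2 m3 N)%:C%C]].
Arguments lambda_set R : clear implicits.

(* Main.v *)
Require Import Defs.
From mathcomp Require Import all_boot all_order all_algebra.
From mathcomp Require Import all_classical all_reals all_analysis.
From mathcomp Require Import complex.
From mathcomp Require Import zify ring lra.

Set Implicit Arguments.
Unset Strict Implicit.
Unset Printing Implicit Defensive.

Import Order.TTheory GRing.Theory Num.Theory.
Import numFieldNormedType.Exports.

Local Open Scope classical_set_scope.
Local Open Scope ring_scope.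

(** The end makes the tree a genealogy: every vertex has one parent and [q] children, and
    the height [busemann] grows by one from a parent to its children
    ([adj_parentP], [busemann_parent], [children_exist]). A step of the walk moves one
    coordinate to its parent and another one to a child.

    The spectrum lies in the interval from -1/2 to 1. Let [U] send a function to its
    sums over the [i]-th children, added over the three indices [i]. Then [6 q P] plus the
    sum of the three sibling operators is [U* U], hence nonnegative, while each sibling
    operator is at most [q]; this gives [P >= -1/2], and [P <= 1] is clear
    ([lab_adj_lower], [lab_adj_upper]). For [z] outside the interval some disk contains
    the interval but not [z], and a Neumann series around its centre inverts [P - z]
    ([spectrum_subset]).

    Eigenfunctions come from tetrahedra. Take one pair of siblings in each tree and the
    difference of the indicator functions of the branches below them. The product of
    these three Haar functions with a function [phi] of the depths is supported on finitely
    many points, and [P] acts on [phi] as the simple random walk on a triangle of the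
    triangular lattice, killed at the boundary ([tetra_moves]). Characters antisymmetrised
    under the Weyl group of type A2 solve this problem ([psi_shift], [psi_wall]); the
    regular ones are indexed by the weights in an alcove, and their eigenvalues are the
    numbers [lambda_mN] ([regular_in_alcove], [lambda_sub_eigenvalues]).

    There are no other eigenvalues. By Fourier inversion ([fourier_inversion]) an
    eigenfunction for another eigenvalue is orthogonal to every product of Haar functions
    restricted to fixed depths ([haar3_sum]). A square-summable function orthogonal to all
    of them vanishes, because it equals its averages over cousins of any order and these
    tend to zero ([haar_complete], [haar_complete3]).

    Finally the eigenvalues are dense in the interval ([lambda_set_dense]) and limits of
    eigenvalues belong to the spectrum ([approximate_eigenvalue]), so the spectrum, the
    interval and the closure of the set of eigenvalues coincide. *)

(** * Rays towards a fixed end of a tree *)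

Section TreeGeometry.
Variables (T : choiceType) (e : rel T) (q : nat).
Hypothesis hT : homogeneous_tree e q.

(** Walks without backtracking; in a tree these are the geodesics. *)
Definition reduced (w : nat -> T) n :=
  (forall i, (i < n)%N -> e (w i) (w i.+1)) /\
  (forall i, (i.+1 < n)%N -> w i <> w i.+2).

Lemma reduced_shift w k n : reduced w (k + n) -> reduced (fun i => w (k + i)%N) n.
Proof.
move=> [h1 h2]; split=> i im; rewrite ?addnS.
  by apply: h1; rewrite ltn_add2l.
by apply: h2; rewrite -addnS ltn_add2l.
Qed.

Lemma last_iota i d : last i (iota i.+1 d) = (i + d)%N.
Proof. by elim: d i => [|d IH] i /=; rewrite ?addn0 // IH addSnnS. Qed.

Lemma path_walk (w : nat -> T) i d :
  (forall k, (k < i + d)%N -> e (w k) (w k.+1)) ->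
  path e (w i) [seq w k | k <- iota i.+1 d].
Proof.
elim: d i => [//|d IH] i h /=; apply/andP; split; first by apply: h; lia.
by apply: IH => k kd; apply: h; lia.
Qed.

(** A shortest closed piece of the walk would be a cycle of length at least 3. *)
Lemma reduced_neq w n i j : reduced w n -> (i < j)%N -> (j <= n)%N -> w i <> w j.
Proof.
move=> [h1 h2] ij jn.
have [d jE] : exists d, j = (i + d.+1)%N by exists (j - i.+1)%N; lia.
move: ij jn; rewrite {}jE => _.
elim/ltn_ind: d i => d IH i dn E.
have hc : ucycle e [seq w k | k <- iota i d.+1].
  rewrite /ucycle /=; apply/andP; split.
    rewrite rcons_path path_walk; last by move=> k kd; apply: h1; lia.
    rewrite (_ : w i = w (i + d.+1)%N) //.
    have -> : last (w (i + d.+1)%N) [seq w k | k <- iota i.+1 d] = w (i + d)%N.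
      by rewrite -E (last_map w (iota i.+1 d) i) last_iota.
    by rewrite addnS; apply: h1; lia.
  suff: uniq [seq w k | k <- iota i d.+1] by [].
  suff inj (a b : nat) : (i <= a < i + d.+1)%N -> (i <= b < i + d.+1)%N ->
      w a = w b -> a = b.
    by rewrite map_inj_in_uniq ?iota_uniq // => a b; rewrite !mem_iota; exact: inj.
  move=> ha hb ab.
  have [lt|lt|//] := ltngtP a b.
    exfalso; apply: (IH (b - a).-1 _ a); try lia.
    by rewrite ab; congr w; lia.
  exfalso; apply: (IH (a - b).-1 _ b); try lia.
  by rewrite -ab; congr w; lia.
have := tree_acyclic hT hc; rewrite size_map size_iota.
case: d IH dn E hc => [|[|d]] // IH dn E hc _.
  have := h1 i; rewrite -addn1 -E (tree_irr hT) => /(_ _); rewrite addn1.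
  by move=> /(_ ltac:(lia)).
by apply: (h2 i); [lia | rewrite E; congr w; lia].
Qed.

Lemma reduced_inj w n i j : reduced w n -> (i <= n)%N -> (j <= n)%N ->
  w i = w j -> i = j.
Proof.
move=> hw hi hj E; have [lt|lt|//] := ltngtP i j.
  by case: (reduced_neq hw lt hj).
by case: (reduced_neq hw lt hi).
Qed.

(** If the first steps differ, the reversed second walk followed by the first one is
    again reduced, and it is closed. *)
Lemma reduced_unique w w' n n' : reduced w n -> reduced w' n' ->
  w 0%N = w' 0%N -> w n = w' n' -> n = n' /\ forall i, (i <= n)%N -> w i = w' i.
Proof.
elim: n n' w w' => [|n IH] n' w w' hw hw' E0 En.
  have := reduced_inj hw' (leq0n _) (leqnn _); rewrite -E0 => /(_ En) n0.
  by split=> // i; rewrite leqn0 => /eqP ->.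
case: n' hw' En => [|n'] hw' En.
  by have := reduced_inj hw (leq0n _) (leqnn _); rewrite E0 En => /(_ erefl).
have [E1|N1] := pselect (w 1%N = w' 1%N).
  have [//|/=|->h] := IH n' _ _ (reduced_shift (k := 1) hw) (reduced_shift (k := 1) hw').
    by rewrite !add1n.
  by split=> // -[|i] // hi; rewrite -!(add1n i); apply: h.
(* the second walk backwards, then the first walk *)
pose g i := if (i <= n'.+1)%N then w' (n'.+1 - i)%N else w (i - n'.+1)%N.
have hg : reduced g (n'.+1 + n.+1).
  case: hw => a1 a2; case: hw' => b1 b2; split=> i hi; rewrite /g.
    have [l1|l1] := leqP i.+1 n'.+1.
      rewrite ltnW //= (tree_sym hT) (_ : (n'.+1 - i)%N = (n'.+1 - i.+1).+1); last lia.
      by apply: b1; lia.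
    have [l2|l2] := leqP i n'.+1.
      have -> : i = n'.+1 by lia.
      by rewrite subnn subSnn -E0; apply: a1.
    by rewrite (subSn (ltnW l2)); apply: a1; lia.
  have [l1|l1] := leqP i.+2 n'.+1.
    rewrite (_ : (i <= n'.+1)%N = true); last by lia.
    rewrite (_ : (n'.+1 - i)%N = (n'.+1 - i.+2).+2); last lia.
    by move=> /esym; apply: b2; lia.
  have [l2|l2] := leqP i n'.+1; last first.
    rewrite (_ : (i.+2 - n'.+1)%N = (i - n'.+1).+2); last lia.
    by apply: a2; lia.
  have [Ei|Ei] : i = n'.+1 \/ i = n' by lia.
    rewrite Ei in hi *.
    rewrite subnn (_ : (n'.+3 - n'.+1)%N = 2%N); last by lia.
    by rewrite -E0; apply: a2; lia.
  rewrite Ei subSnn (_ : (n'.+2 - n'.+1)%N = 1%N); last by lia.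
  by move=> /esym.
have := reduced_inj hg (leq0n _) (leqnn _).
rewrite /g leq0n subn0 (_ : (n'.+1 + n.+1 <= n'.+1)%N = false); last lia.
by rewrite addKn En => /(_ erefl).
Qed.

Lemma path_reduced x p : path e x p -> uniq (x :: p) ->
  reduced (nth x (x :: p)) (size p).
Proof.
move=> hp hu; split=> i hi; first by apply: (pathP x hp).
by move=> /eqP; rewrite nth_uniq //= ?ltnS; lia.
Qed.

Lemma gdist_reduced w n : reduced w n -> gdist e (w 0%N) (w n) = n.
Proof.
move=> hw; pose p := [seq w k | k <- iota 1 n].
have hp : path e (w 0%N) p by apply: path_walk; case: hw.
have sp : size p = n by rewrite size_map size_iota.
have lp : last (w 0%N) p = w n.
  by rewrite (last_map w (iota 1 n) 0%N) last_iota.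
have min p' : path e (w 0%N) p' -> last (w 0%N) p' = w n -> (n <= size p')%N.
  move=> hp'; case/shortenP: hp' => p1 hp1 up1 sub1 l1.
  have [-> _] := reduced_unique hw (path_reduced hp1 up1) erefl
    (etrans (esym l1) (last_nth _ _ _)).
  by apply: uniq_leq_size => //; case/andP: up1.
rewrite /gdist; case: xgetP => [k _ [[p' [a b <-]] kmin]|/(_ n)].
  by have := kmin p hp lp; have := min p' a b; rewrite sp; lia.
by case; split=> //; exists p.
Qed.

Lemma gdist_path x y : exists p, [/\ path e x p, last x p = y & size p = gdist e x y].
Proof.
have [p hp <-] := tree_connected hT x y; case/shortenP: hp => p1 hp1 up1 _.
exists p1; split=> //; rewrite (_ : last x p1 = nth x (x :: p1) (size p1)); last first.
  by rewrite (last_nth x).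
by have := gdist_reduced (path_reduced hp1 up1).
Qed.

Lemma geodesic_rayP (r : nat -> T) : geodesic_ray e r <-> forall n, reduced r n.
Proof.
split=> [hr n|hr m n mn].
  split=> i _.
    have [p [hp lp]] := gdist_path (r i) (r i.+1); rewrite hr // subSnn.
    by case: p hp lp => [|y []] //=; rewrite andbT => + <-.
  move=> E; have := hr i i.+2 ltac:(lia); rewrite -E.
  rewrite (gdist_reduced (w := fun=> r i) (n := 0)) ?subn0; last by split.
  by lia.
have := reduced_shift (k := m) (n := n - m) (hr (m + (n - m))%N).
by move=> /gdist_reduced; rewrite addn0 subnKC.
Qed.

Lemma equiv_ray_sym (r s : nat -> T) : equiv_ray r s -> equiv_ray s r.
Proof. by rewrite /equiv_ray setUC. Qed.

Lemma equiv_ray_trans (r s t : nat -> T) : equiv_ray r s -> equiv_ray s t -> equiv_ray r t.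
Proof.
rewrite /equiv_ray => h1 h2; apply: (sub_finite_set (B := _ `|` _)); last first.
  by rewrite finite_setU; split; [exact: h1|exact: h2].
move=> x [[a b]|[a b]]; have [c|c] := pselect (range s x).
- by right; left.
- by left; left.
- by left; right.
- by right; right.
Qed.

Lemma equiv_ray_shift (r : nat -> T) : equiv_ray r (fun n => r n.+1).
Proof.
apply: (@sub_finite_set _ _ [set r 0%N]); last exact: finite_set1.
move=> x [[[[|n] _ <-] h]|[[n _ <-] h]] //.
Qed.

Variables (omega : set (nat -> T)).
Hypothesis homega : is_end e omega.

Let ray_eq r : omega r -> forall s, omega s <-> geodesic_ray e s /\ equiv_ray r s.
Proof.
have [r0 h0 ->] := homega; move=> [hr er] s /=; split=> -[hs es]; split=> //.
  by apply: equiv_ray_trans es; apply: equiv_ray_sym.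
by apply: equiv_ray_trans es.
Qed.

Let ray_geo r : omega r -> geodesic_ray e r.
Proof. by move=> h; have [] := (ray_eq h r).1 h. Qed.

Lemma end_shift r : omega r -> omega (fun n => r n.+1).
Proof.
move=> h; apply/(ray_eq h); split; last exact: equiv_ray_shift.
by move=> m n mn; rewrite (ray_geo h) ?subSS.
Qed.

Definition cons_ray x (r : nat -> T) n := if n is n'.+1 then r n' else x.

Lemma end_cons r x : omega r -> e x (r 0%N) -> r 1%N <> x -> omega (cons_ray x r).
Proof.
move=> h ex ne; have hr := (geodesic_rayP r).1 (ray_geo h).
apply/(ray_eq h); split; last exact/equiv_ray_sym/(equiv_ray_shift (cons_ray x r)).
apply/geodesic_rayP => n; split=> -[|i] hi //=.
- by have [+ _] := hr i.+1; apply.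
- by move=> /esym.
- by have [_] := hr i.+2; apply.
Qed.

(** A ray of [omega] is transported along an edge: either it starts with that edge,
    which is then removed, or it can be prolonged by it. *)
Lemma end_ray_exists x : exists r, omega r /\ r 0%N = x.
Proof.
have [r0 hr0 oE] := homega.
have h0 : omega r0 by rewrite oE; split=> //; rewrite /equiv_ray setDv setU0.
have [p] := tree_connected hT (r0 0%N) x.
elim/last_ind: p x => [|p y IH] x; first by move=> _ <-; exists r0.
rewrite rcons_path last_rcons => /andP[hp ey] <-.
have [r [hr r0E]] := IH _ hp erefl.
have [E|N] := pselect (r 1%N = y); first by exists (fun n => r n.+1); split; first exact: end_shift.
by exists (cons_ray y r); split=> //; apply: end_cons => //; rewrite r0E (tree_sym hT).
Qed.

Lemma end_rays_meet r s : omega r -> omega s -> forall n, exists2 m, (n <= m)%N & range s (r m).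
Proof.
move=> hr hs n; have [hs' er] := (ray_eq hr s).1 hs.
apply: contrapT => no; have ir := (geodesic_rayP r).1 (ray_geo hr).
have inj : injective r.
  by move=> a b; apply: (reduced_inj (ir (maxn a b))); rewrite ?leq_maxl ?leq_maxr.
have fin := finite_preimage (in2W inj) er.
apply: infinite_nat; apply: (@sub_finite_set _ _ (`I_n `|` r @^-1` (range r `\` range s `|` range s `\` range r))).
  move=> m _; have [mn|nm] := ltnP m n; [by left|right]; left; split; first by exists m.
  by move=> h; apply: no; exists m.
by rewrite finite_setU; split=> //; exact: finite_II.
Qed.

(** Equivalent rays meet arbitrarily far out, and up to each meeting point both are
    the reduced walk from their common origin. *)
Lemma end_ray_unique r s : omega r -> omega s -> r 0%N = s 0%N -> r =1 s.
Proof.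
move=> hr hs E n; have [m nm [k _ kE]] := end_rays_meet hr hs n.
have [_ h] := reduced_unique ((geodesic_rayP r).1 (ray_geo hr) m)
  ((geodesic_rayP s).1 (ray_geo hs) k) E (esym kE).
exact: h.
Qed.

Lemma ray_fromP x : omega (ray_from omega x) /\ ray_from omega x 0%N = x.
Proof.
rewrite /ray_from; case: xgetP => [r _ //|no].
by have [r hr] := end_ray_exists x; case: (no r).
Qed.

Definition parent x := ray_from omega x 1%N.

Lemma ray_fromE x n : ray_from omega x n = iter n parent x.
Proof.
elim: n x => [|n IH] x; first by case: (ray_fromP x).
rewrite iterSr -IH; have [h1 h2] := ray_fromP x; have [h3 h4] := ray_fromP (parent x).
exact: (end_ray_unique (end_shift h1) h3).
Qed.

Lemma iter_parent_reduced x n : reduced (fun k => iter k parent x) n.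
Proof.
have [/ray_geo/geodesic_rayP/(_ n) [h1 h2] _] := ray_fromP x.
by split=> i hi; rewrite -!ray_fromE; [apply: h1 | apply: h2].
Qed.

Lemma adj_parent x : e x (parent x).
Proof. by have [h _] := iter_parent_reduced x 1; exact: (h 0%N). Qed.

(** If [parent y] is not [x], the ray from [x] prolonged by [y] is the ray from [y],
    unless it already passes through [y]. *)
Lemma adj_parentP x y : e x y = (parent x == y) || (parent y == x).
Proof.
apply/idP/orP => [h|[/eqP <-|/eqP <-]]; last 2 first.
- exact: adj_parent.
- by rewrite (tree_sym hT) adj_parent.
have [h1 h2] := ray_fromP x; have [h3 h4] := ray_fromP y.
have [_|ne] := eqVneq (parent y) x; [by right|left; apply/eqP].
have hc : omega (cons_ray y (ray_from omega x)) \/ parent x = y.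
  have [->|N] := pselect (parent x = y); [by right|left].
  by apply: end_cons => //; rewrite h2 (tree_sym hT).
case: hc => // hc; case/eqP: ne.
by have := end_ray_unique h3 hc h4 1%N; rewrite /= h2.
Qed.

Lemma iter_parent_inj x i j : iter i parent x = iter j parent x -> i = j.
Proof.
by apply: (reduced_inj (iter_parent_reduced x (maxn i j))); rewrite ?leq_maxl ?leq_maxr.
Qed.

Lemma meet_parentP x y : exists n m, iter n parent x = iter m parent y.
Proof.
have [h1 _] := ray_fromP x; have [h3 _] := ray_fromP y.
have [n _ [m _ E]] := end_rays_meet h1 h3 0%N.
by exists n, m; rewrite -!ray_fromE.
Qed.

Variable o : T.
Local Notation h := (busemann e omega o).

(** Every common ancestor gives the same difference, not only the maximal one. *)
Lemma busemannE x n m : iter n parent x = iter m parent o -> h x = n%:Z - m%:Z.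
Proof.
move=> E; rewrite /busemann /common_ancestor; case: xgetP => [v _|no]; last first.
  have ex : exists n, `[< range (ray_from omega o) (ray_from omega x n) >].
    by exists n; apply/asboolP; exists m => //; rewrite !ray_fromE.
  have [k /asboolP hk kmin] := ex_minnP ex.
  case: (no (ray_from omega x k)); exists k; split=> // j jk hj.
  by have := kmin j (introT (asboolP _) hj); rewrite leqNgt jk.
move=> [k [-> [l _ El] kmin]]; move: El; rewrite !ray_fromE => El.
have -> : gdist e x (iter k parent x) = k := gdist_reduced (iter_parent_reduced x k).
rewrite -El; have -> : gdist e o (iter l parent o) = l := gdist_reduced (iter_parent_reduced o l).
have kn : (k <= n)%N.
  rewrite leqNgt; apply/negP => nk; apply: (kmin n nk).
  by exists m => //; rewrite !ray_fromE.
have : iter m parent o = iter (n - k + l) parent o by rewrite iterD El -iterD subnK.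
by move=> /iter_parent_inj; lia.
Qed.

Lemma busemann_parent x : h (parent x) = h x - 1.
Proof.
have [n [m E]] := meet_parentP (parent x) o.
rewrite (busemannE E) (@busemannE x n.+1 m) ?iterSr //; lia.
Qed.

Lemma busemann_root : h o = 0.
Proof. by rewrite (@busemannE o 0 0). Qed.

Lemma children_exist x : exists s : seq T,
  [/\ uniq s, size s = q & forall y, (y \in s) = (parent y == x)].
Proof.
have [s [us ss hs]] := tree_regular hT x.
exists (rem (parent x) s); split; first exact: rem_uniq.
  by rewrite size_rem ?ss // hs adj_parent.
move=> y; rewrite mem_rem_uniq // inE hs adj_parentP eq_sym.
have [E|//] /= := eqVneq (parent x) y; apply/esym/negbTE/eqP => E2.
have := busemann_parent x; have := busemann_parent y; rewrite E2 -E; lia.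
Qed.

End TreeGeometry.

(** * Quadratic forms on finite lists *)

Section FiniteForms.
Variables (R : realType).

Lemma ler_sum_sub (V : choiceType) (s s' : seq V) (F : V -> R) :
  uniq s -> uniq s' -> {subset s <= s'} -> (forall x, 0 <= F x) ->
  \sum_(x <- s) F x <= \sum_(x <- s') F x.
Proof.
move=> us us' ss F0.
have p : perm_eq s' (s ++ [seq x <- s' | x \notin s]).
  apply: uniq_perm => //.
    rewrite cat_uniq us filter_uniq // andbT /=; apply/hasPn => x.
    by rewrite mem_filter => /andP[].
  move=> x; rewrite mem_cat mem_filter; have [/ss ->|_] //= := boolP (x \in s).
by rewrite (perm_big _ p) big_cat /= lerDl sumr_ge0.
Qed.

Lemma sum_delta (V : choiceType) (s : seq V) (v : V) (F : V -> R) : uniq s -> v \in s ->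
  \sum_(x <- s) (v == x)%:R * F x = F v.
Proof.
move=> us vs; rewrite (bigD1_seq v) //= eqxx mul1r big1 ?addr0 // => x.
by rewrite eq_sym => /negbTE ->; rewrite mul0r.
Qed.

(** A sum of squares, one for each label. *)
Lemma gram_ge0 (I : eqType) (Z : choiceType) (l : seq I) (lab : I -> Z) (w : I -> R) :
  0 <= \sum_(a <- l) \sum_(b <- l) (lab a == lab b)%:R * (w a * w b).
Proof.
pose s := undup (map lab l).
have E : \sum_(a <- l) \sum_(b <- l) (lab a == lab b)%:R * (w a * w b) =
  \sum_(z <- s) (\sum_(a <- l) (lab a == z)%:R * w a) ^+ 2.
  transitivity (\sum_(z <- s) \sum_(a <- l) \sum_(b <- l)
     (lab a == z)%:R * ((lab b == z)%:R * (w a * w b))).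
    rewrite [RHS]exchange_big /= big_seq [RHS]big_seq; apply: eq_bigr => a al.
    rewrite [RHS]exchange_big /=; apply: eq_bigr => b _.
    by rewrite (sum_delta (fun z => (lab b == z)%:R * (w a * w b))) ?undup_uniq //
      ?mem_undup ?map_f // eq_sym.
  apply: eq_bigr => z _; rewrite expr2 mulr_suml; apply: eq_bigr => a _.
  by rewrite mulr_sumr; apply: eq_bigr => b _; ring.
by rewrite E; apply: sumr_ge0 => z _; apply: sqr_ge0.
Qed.

(** Polarisation with the vector [g] equal to [M^-1] times the image of [f]. *)
Lemma symmetric_form_norm (V : choiceType) (s : seq V) (B : V -> V -> R) (M : R) :
  0 < M -> (forall x y, B x y = B y x) ->
  (forall g : V -> R, `|\sum_(x <- s) \sum_(y <- s) B x y * (g x * g y)| <=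
     M * \sum_(x <- s) g x ^+ 2) ->
  forall f : V -> R, \sum_(x <- s) (\sum_(y <- s) B x y * f y) ^+ 2 <=
     M ^+ 2 * \sum_(x <- s) f x ^+ 2.
Proof.
move=> M0 Bs hB f; set S2 := \sum_(x <- s) f x ^+ 2.
pose g x := M^-1 * \sum_(y <- s) B x y * f y.
set N2 := (X in X <= _).
have sg : \sum_(x <- s) g x ^+ 2 = M^-2 * N2.
  by rewrite mulr_sumr; apply: eq_bigr => x _; rewrite /g exprMn exprVn.
have cross : \sum_(x <- s) \sum_(y <- s) B x y * (g x * f y) = M^-1 * N2.
  rewrite mulr_sumr; apply: eq_bigr => x _.
  transitivity (g x * \sum_(y <- s) B x y * f y); last by rewrite /g; ring.
  by rewrite mulr_sumr; apply: eq_bigr => y _; ring.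
have cross' : \sum_(x <- s) \sum_(y <- s) B x y * (f x * g y) = M^-1 * N2.
  rewrite exchange_big -cross; apply: eq_bigr => x _; apply: eq_bigr => y _.
  by rewrite Bs (mulrC (f y)).
have polar : \sum_(x <- s) \sum_(y <- s) B x y * ((f x + g x) * (f y + g y)) -
    \sum_(x <- s) \sum_(y <- s) B x y * ((f x - g x) * (f y - g y)) = 4 * (M^-1 * N2).
  rewrite (_ : 4 * (M^-1 * N2) = 2 * (M^-1 * N2) + 2 * (M^-1 * N2)); last by ring.
  rewrite -{1}cross -cross' !mulr_sumr -sumrB -big_split; apply: eq_bigr => x _ /=.
  rewrite !mulr_sumr -sumrB -big_split; apply: eq_bigr => y _ /=; ring.
have para : \sum_(x <- s) (f x + g x) ^+ 2 + \sum_(x <- s) (f x - g x) ^+ 2 =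
    2 * (S2 + M^-2 * N2).
  by rewrite -sg -!big_split mulr_sumr; apply: eq_bigr => x _ /=; ring.
have hp := hB (fun x => f x + g x); have hm := hB (fun x => f x - g x).
have := le_trans (ler_normB _ _) (lerD hp hm).
rewrite polar -mulrDr para => /(le_trans (ler_norm _)) h.
have h2 : 4 * (M^-1 * N2) * M = 4 * N2 by field; rewrite gt_eqF.
have h3 : M * (2 * (S2 + M ^- 2 * N2)) * M = 2 * (M ^+ 2 * S2) + 2 * N2.
  by field; rewrite gt_eqF.
have := ler_wpM2r (ltW M0) h; rewrite h2 h3; lra.
Qed.

End FiniteForms.

Section LabelledForms.
Variables (R : realType) (V Z : choiceType) (u : 'I_3 -> V -> Z) (q : nat).
Hypothesis fibre : forall i z (s : seq V), uniq s -> (count (fun y => u i y == z) s <= q)%N.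

(** Each point carries three labels, and two points are joined once for every label of
    the first that is a label of the second with a different index. In the graph DL
    the [i]-th label of a point is obtained by moving its [i]-th coordinate to its
    parent. *)
Definition lab_adj (x y : V) : R := \sum_i \sum_(j | j != i) (u i x == u j y)%:R.

Lemma lab_adj_sym x y : lab_adj x y = lab_adj y x.
Proof.
rewrite /lab_adj (exchange_big_dep predT) //=; apply: eq_bigr => i _.
by apply: eq_big => [j|j _]; rewrite eq_sym.
Qed.

(** Cauchy-Schwarz, since a label is shared by at most [q] points. *)
Lemma lab_form_bound (s : seq V) (us : uniq s) i j (g : V -> R) :
  `|\sum_(x <- s) \sum_(y <- s) (u i x == u j y)%:R * (g x * g y)| <=
    q%:R * \sum_(x <- s) g x ^+ 2.
Proof.
have count_le k z : \sum_(y <- s) (z == u k y)%:R <= q%:R :> R.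
  rewrite (eq_bigr (fun y => (u k y == z)%:R)) => [|y _]; last by rewrite eq_sym.
  rewrite -natr_sum ler_nat; apply: leq_trans (fibre k z us).
  by rewrite -sum1_count [X in (_ <= X)%N]big_mkcond; apply: leq_sum => y _; case: eqP.
have half k l : \sum_(x <- s) \sum_(y <- s) (u k x == u l y)%:R * g x ^+ 2 <=
    q%:R * \sum_(x <- s) g x ^+ 2.
  rewrite mulr_sumr; apply: ler_sum => x _.
  by rewrite -mulr_suml ler_wpM2r ?sqr_ge0.
have half2 : \sum_(x <- s) \sum_(y <- s) (u i x == u j y)%:R * g y ^+ 2 <=
    q%:R * \sum_(x <- s) g x ^+ 2.
  rewrite exchange_big /=; apply: le_trans (half j i); apply: ler_sum => x _.
  by apply: ler_sum => y _; rewrite eq_sym.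
have : `|\sum_(x <- s) \sum_(y <- s) (u i x == u j y)%:R * (g x * g y)| <=
    \sum_(x <- s) \sum_(y <- s) 2^-1 * ((u i x == u j y)%:R * g x ^+ 2 +
      (u i x == u j y)%:R * g y ^+ 2).
  apply: le_trans (ler_norm_sum _ _ _) _; apply: ler_sum => x _.
  apply: le_trans (ler_norm_sum _ _ _) _; apply: ler_sum => y _.
  case: eqP => _; rewrite ?mul1r ?mul0r ?normr0 ?addr0 ?mulr0 //.
  have := sqr_ge0 (g x - g y); have := sqr_ge0 (g x + g y).
  by case: (ger0P (g x * g y)) => _; nra.
move=> /le_trans; apply.
have := lerD (half i j) half2; rewrite -big_split /=.
under eq_bigr do rewrite -big_split /=.
by under [X in _ -> X <= _]eq_bigr do rewrite -mulr_sumr; rewrite -mulr_sumr; lra.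
Qed.

Lemma lab_adj_form (s : seq V) (g : V -> R) :
  \sum_(x <- s) \sum_(y <- s) lab_adj x y * (g x * g y) =
  \sum_i \sum_(j | j != i)
    \sum_(x <- s) \sum_(y <- s) (u i x == u j y)%:R * (g x * g y).
Proof.
transitivity (\sum_(x <- s) \sum_i \sum_(j | j != i) \sum_(y <- s)
    (u i x == u j y)%:R * (g x * g y)).
  apply: eq_bigr => x _.
  under eq_bigr do rewrite /lab_adj mulr_suml.
  rewrite exchange_big /=; apply: eq_bigr => i _.
  under eq_bigr do rewrite mulr_suml.
  by rewrite exchange_big.
by rewrite exchange_big /=; apply: eq_bigr => i _; rewrite exchange_big.
Qed.

Lemma lab_adj_upper (s : seq V) (us : uniq s) (g : V -> R) :
  \sum_(x <- s) \sum_(y <- s) lab_adj x y * (g x * g y) <=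
    (6 * q)%:R * \sum_(x <- s) g x ^+ 2.
Proof.
rewrite lab_adj_form.
apply: (@le_trans _ _ (\sum_(i : 'I_3) \sum_(j | j != i) q%:R * \sum_(x <- s) g x ^+ 2)).
  apply: ler_sum => i _; apply: ler_sum => j _.
  exact: le_trans (ler_norm _) (lab_form_bound us i j g).
rewrite !big_ord_recl big_ord0 /= !(big_mkcond (fun j => j != _)) /=.
by rewrite !big_ord_recl !big_ord0 /= natrM; lra.
Qed.

(** Adding the terms with [i = j] turns the adjacency form into a Gram form, and these
    three terms amount to at most [3 q]. After division by [6 q] this is the lower
    bound -1/2. *)
Lemma lab_adj_lower (s : seq V) (us : uniq s) (g : V -> R) :
  - (3 * q)%:R * \sum_(x <- s) g x ^+ 2 <=
  \sum_(x <- s) \sum_(y <- s) lab_adj x y * (g x * g y).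
Proof.
pose l := [seq (x, i) | x <- s, i <- enum 'I_3].
have := gram_ge0 l (fun p => u p.2 p.1) (fun p => g p.1).
rewrite big_allpairs_dep /=.
under eq_bigr do rewrite big_enum /=.
under eq_bigr do under eq_bigr do rewrite big_allpairs_dep /=.
under eq_bigr do under eq_bigr do under eq_bigr do rewrite big_enum /=.
rewrite exchange_big /=.
under eq_bigr do under eq_bigr do rewrite exchange_big /=.
under eq_bigr do rewrite exchange_big /=.
under eq_bigr => i _ do rewrite (bigD1 i) //=.
rewrite big_split /= -lab_adj_form => h.
have hd : \sum_(i : 'I_3) \sum_(x <- s) \sum_(y <- s) (u i x == u i y)%:R * (g x * g y) <=
    (3 * q)%:R * \sum_(x <- s) g x ^+ 2.
  apply: (@le_trans _ _ (\sum_(i : 'I_3) q%:R * \sum_(x <- s) g x ^+ 2)).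
    by apply: ler_sum => i _; apply: le_trans (ler_norm _) (lab_form_bound us i i g).
  by rewrite !big_ord_recl big_ord0 /= natrM; lra.
by move: h hd; lra.
Qed.

Hypothesis q0 : (0 < q)%N.

(** The interval from -1/2 to 1 has centre 1/4 and radius 3/4. *)
Lemma centred_norm (s : seq V) (us : uniq s) (f : V -> R) :
  \sum_(x <- s) ((6 * q)%:R^-1 * \sum_(y <- s) lab_adj x y * f y - 4^-1 * f x) ^+ 2 <=
  (3 / 4) ^+ 2 * \sum_(x <- s) f x ^+ 2.
Proof.
pose B x y : R := (6 * q)%:R^-1 * lab_adj x y - 4^-1 * (x == y)%:R.
have q6 : 0 < (6 * q)%:R :> R by rewrite ltr0n muln_gt0.
have delta (F : V -> R) x : x \in s -> \sum_(y <- s) (x == y)%:R * F y = F x.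
  exact: sum_delta.
have Bf (F : V -> R) x : x \in s -> \sum_(y <- s) B x y * F y =
    (6 * q)%:R^-1 * \sum_(y <- s) lab_adj x y * F y - 4^-1 * F x.
  move=> xs; rewrite -[in RHS](delta F) // !mulr_sumr -sumrB.
  by apply: eq_bigr => y _; rewrite /B; ring.
rewrite big_seq; under eq_bigr => x xs do rewrite -Bf //; rewrite -big_seq.
apply: symmetric_form_norm => [|x y|g]; first by lra.
  by rewrite /B lab_adj_sym eq_sym.
have -> : \sum_(x <- s) \sum_(y <- s) B x y * (g x * g y) =
   (6 * q)%:R^-1 * (\sum_(x <- s) \sum_(y <- s) lab_adj x y * (g x * g y)) -
   4^-1 * \sum_(x <- s) g x ^+ 2.
  rewrite !mulr_sumr -sumrB big_seq [RHS]big_seq; apply: eq_bigr => x xs.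
  rewrite (Bf (fun y => g x * g y)) //; ring.
have := lab_adj_lower us g; have := lab_adj_upper us g.
set Q := \sum_(x <- s) \sum_(y <- s) lab_adj x y * (g x * g y).
set S := \sum_(x <- s) g x ^+ 2 => hu hl.
have i6 : 0 <= (6 * q)%:R^-1 :> R by rewrite invr_ge0 ltW.
have := ler_wpM2l i6 hu; have := ler_wpM2l i6 hl.
rewrite (mulrA _ (6 * q)%:R) mulVf ?gt_eqF // mul1r.
have -> : (6 * q)%:R^-1 * (- (3 * q)%:R * S) = - 2^-1 * S.
  have : q%:R != 0 :> R by rewrite pnatr_eq0 -lt0n.
  by rewrite !natrM => ?; field.
by move=> h1 h2; rewrite ler_norml; apply/andP; split; lra.
Qed.

End LabelledForms.

(** * Square-summable functions and Neumann series *)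

Section ComplexSquares.
Variables (R : realType).
Local Notation C := R[i].

Definition nsq (z : C) : R := complex.Re z ^+ 2 + complex.Im z ^+ 2.

Lemma normc_nsq z : Normc.normc z ^+ 2 = nsq z.
Proof. by case: z => a b; rewrite /nsq /= sqr_sqrtr // addr_ge0 ?sqr_ge0. Qed.

Lemma nsq_ge0 z : 0 <= nsq z.
Proof. by rewrite addr_ge0 ?sqr_ge0. Qed.

Lemma nsqM a b : nsq (a * b) = nsq a * nsq b.
Proof. by rewrite -!normc_nsq Normc.normcM exprMn. Qed.

Lemma nsq_eq0 z : nsq z = 0 -> z = 0.
Proof. by rewrite -normc_nsq => /eqP; rewrite sqrf_eq0 => /eqP/Normc.eq0_normc. Qed.

(** A triangle inequality that involves only squares of norms. *)
Lemma nsqD (t : R) a b : 0 < t ->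
  nsq (a + b) <= (1 + t) * nsq a + (1 + t^-1) * nsq b.
Proof.
case: a b => [a1 a2] [b1 b2] t0; rewrite /nsq /=.
have key (x y : R) : (x + y) ^+ 2 <= (1 + t) * x ^+ 2 + (1 + t^-1) * y ^+ 2.
  rewrite -subr_ge0.
  have -> : (1 + t) * x ^+ 2 + (1 + t^-1) * y ^+ 2 - (x + y) ^+ 2 = t^-1 * (t * x - y) ^+ 2.
    by field; rewrite gt_eqF.
  by rewrite mulr_ge0 ?sqr_ge0 // invr_ge0 ltW.
by have := key a1 b1; have := key a2 b2; lra.
Qed.

Lemma sum_support (V : choiceType) (s s' : seq V) (F : V -> C) : uniq s -> uniq s' ->
  (forall v, v \notin s -> F v = 0) -> (forall v, v \notin s' -> F v = 0) ->
  \sum_(v <- s) F v = \sum_(v <- s') F v.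
Proof.
move=> us us' h h'.
have part (l l' : seq V) : uniq l -> (forall v, v \notin l' -> F v = 0) ->
    \sum_(v <- l) F v = \sum_(v <- [seq v <- l | v \in l']) F v.
  move=> ul hl; rewrite big_filter [RHS]big_mkcond; apply: eq_bigr => v _.
  by case: (boolP (v \in l')) => // /hl.
rewrite (part s s') // (part s' s) //; apply: perm_big.
apply: uniq_perm; rewrite ?filter_uniq // => v; rewrite !mem_filter; exact: andbC.
Qed.

Lemma nsq_sum (V : Type) (s : seq V) (g : V -> C) :
  nsq (\sum_(y <- s) g y) <= (size s)%:R * \sum_(y <- s) nsq (g y).
Proof.
elim: s => [|y s IH]; first by rewrite !big_nil /nsq /= expr0n addr0 mul0r.
rewrite !big_cons /=; case: s IH => [|z s] IH.
  by rewrite !big_nil !addr0 mul1r.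
have n0 : 0 < (size (z :: s))%:R :> R by rewrite ltr0n.
apply: le_trans (nsqD (g y) _ n0) _; move: IH; set S := nsq (\sum_(j <- z :: s) g j).
set n := (size (z :: s))%:R in n0 *; set Q := \sum_(j <- z :: s) nsq (g j) => IH.
have -> : (size (z :: s)).+1%:R = 1 + n by rewrite -natr1 addrC.
have : (1 + n^-1) * S <= (1 + n^-1) * (n * Q).
  by apply: ler_wpM2l IH; rewrite addr_ge0 // invr_ge0 ltW.
have -> : (1 + n^-1) * (n * Q) = (1 + n) * Q by field; rewrite gt_eqF.
by rewrite mulrDr; lra.
Qed.

End ComplexSquares.

Section EllTwoFinite.
Variables (R : realType) (V : choiceType).
Implicit Types f : V -> R[i].

(** Square summability tested on finite sums only, [K] bounding the square of
    the norm. *)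
Definition bnd f (K : R) := forall s : seq V, uniq s -> \sum_(x <- s) nsq (f x) <= K.

Lemma bnd_ge0 f K : bnd f K -> 0 <= K.
Proof. by move=> /(_ [::] isT); rewrite big_nil. Qed.

Lemma bnd_point f K x : bnd f K -> nsq (f x) <= K.
Proof. by move=> /(_ [:: x] isT); rewrite big_seq1. Qed.

Let sq f (x : V) : \bar R := (Normc.normc (f x) ^+ 2)%:E.

Let esum_sq f : (\esum_(x in setT) sq f x = ereal_sup
   [set (\sum_(x <- s) nsq (f x))%:E | s in [set s : seq V | uniq s]])%E.
Proof.
rewrite /esum; congr ereal_sup; apply/seteqP; split=> [_ [A [fA _] <-]|_ [s us <-]].
  exists (finmap.enum_fset (fset_set A)); first exact: finmap.fset_uniq.
  rewrite fsbig_finite //= sumEFin; congr EFin.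
  by apply: eq_bigr => x _; rewrite normc_nsq.
exists [set` s]; first by split=> //; exact: finite_seq.
by rewrite -fsbig_seq // sumEFin; congr EFin; apply: eq_bigr => x _; rewrite normc_nsq.
Qed.

Let esum_le f K : (\esum_(x in setT) sq f x <= K%:E)%E <-> bnd f K.
Proof.
rewrite esum_sq; split=> [h s us|h].
  rewrite -lee_fin; apply: le_trans h; apply: ereal_sup_ubound.
  by exists s.
by apply: ge_ereal_sup => _ [s us <-]; rewrite lee_fin h.
Qed.

Let esum_ge0' f : (0 <= \esum_(x in setT) sq f x)%E.
Proof. by apply: esum_ge0 => x _; rewrite lee_fin sqr_ge0. Qed.

Let l2_lt f : l2 f <-> (\esum_(x in setT) sq f x < +oo)%E.
Proof.
rewrite /l2 /= /summable (eq_esum (b := sq f)) // => x _.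
by rewrite gee0_abs // lee_fin sqr_ge0.
Qed.

Lemma l2norm_ge0 f : 0 <= l2norm f.
Proof. exact: sqrtr_ge0. Qed.

Lemma bnd_l2norm f : l2 f -> bnd f (l2norm f ^+ 2).
Proof.
move=> /l2_lt lt; apply/esum_le.
have fn : (\esum_(x in setT) sq f x)%E \is a fin_num by rewrite ge0_fin_numE.
rewrite -[leLHS](fineK fn) lee_fin /l2norm sqr_sqrtr; first exact: lexx.
exact: (fine_ge0 (esum_ge0' f)).
Qed.

Lemma bnd_l2 f K : bnd f K -> l2 f.
Proof. by move=> /esum_le h; apply/l2_lt; apply: le_lt_trans h (ltry _). Qed.

Lemma l2norm_le f (K : R) : 0 <= K -> bnd f (K ^+ 2) -> l2norm f <= K.
Proof.
move=> K0 h; have /l2_lt lt := bnd_l2 h; move/esum_le: h => h.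
rewrite /l2norm -(ger0_norm K0) -sqrtr_sqr ler_wsqrtr //.
have fn : (\esum_(x in setT) sq f x)%E \is a fin_num by rewrite ge0_fin_numE.
by rewrite -lee_fin (fineK fn).
Qed.

Lemma bnd_lin (a : R[i]) f g K L (t : R) : 0 < t -> bnd f K -> bnd g L ->
  bnd (fun x => a * f x + g x) ((1 + t) * (nsq a * K) + (1 + t^-1) * L).
Proof.
move=> t0 hf hg s us.
apply: (@le_trans _ _ (\sum_(x <- s) ((1 + t) * (nsq a * nsq (f x)) + (1 + t^-1) * nsq (g x)))).
  by apply: ler_sum => x _; rewrite -nsqM nsqD.
have ti : 0 < t^-1 by rewrite invr_gt0.
rewrite big_split /= -!mulr_sumr; apply: lerD.
  by rewrite !ler_wpM2l ?nsq_ge0 ?hf //; lra.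
by rewrite ler_wpM2l ?hg //; lra.
Qed.

Lemma bnd_scale (a : R[i]) f K : bnd f K -> bnd (fun x => a * f x) (nsq a * K).
Proof.
move=> hf s us; under eq_bigr do rewrite nsqM.
by rewrite -mulr_sumr ler_wpM2l ?nsq_ge0 ?hf.
Qed.

Lemma bnd_le f K L : K <= L -> bnd f K -> bnd f L.
Proof. by move=> KL h s us; apply: le_trans (h s us) KL. Qed.

Lemma l2norm_gt0 f : l2 f -> f <> (fun=> 0) -> 0 < l2norm f.
Proof.
move=> lf ne; rewrite lt_neqAle l2norm_ge0 andbT eq_sym; apply/eqP => E.
apply: ne; apply/funext => x; apply: nsq_eq0; apply/eqP.
by rewrite eq_le nsq_ge0 andbT; have := bnd_point x (bnd_l2norm lf); rewrite E expr0n.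
Qed.

End EllTwoFinite.

Section ComplexLimits.
Variables (R : realType).
Local Notation C := R[i].
Implicit Types (u v : nat -> C) (l : C).

(** Convergence in the complex numbers is taken componentwise, so that it
    reduces to convergence of real sequences. *)
Definition ccvg u l :=
  (fun n => complex.Re (u n)) @ \oo --> complex.Re l /\
  (fun n => complex.Im (u n)) @ \oo --> complex.Im l.

Lemma ccvg_unique u l l' : ccvg u l -> ccvg u l' -> l = l'.
Proof.
move=> [h1 h2] [h3 h4]; have e1 : complex.Re l = complex.Re l' by apply: (cvg_unique _ h1 h3).
have e2 : complex.Im l = complex.Im l' by apply: (cvg_unique _ h2 h4).
by case: l l' e1 e2 {h1 h2 h3 h4} => [a b] [c d] /= -> ->.
Qed.

Lemma ccvg_cst l : ccvg (fun=> l) l.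
Proof. by split; apply: cvg_cst. Qed.

Lemma ccvgD u v l k : ccvg u l -> ccvg v k -> ccvg (fun n => u n + v n) (l + k).
Proof.
move=> [h1 h2] [h3 h4]; split.
  have -> : complex.Re (l + k) = complex.Re l + complex.Re k by case: l k {h1 h2 h3 h4} => ? ? [].
  rewrite (_ : (fun n => _) = (fun n => complex.Re (u n) + complex.Re (v n))).
    exact: cvgD.
  by apply/funext => n; case: (u n) (v n) => ? ? [].
have -> : complex.Im (l + k) = complex.Im l + complex.Im k by case: l k {h1 h2 h3 h4} => ? ? [].
rewrite (_ : (fun n => _) = (fun n => complex.Im (u n) + complex.Im (v n))).
  exact: cvgD.
by apply/funext => n; case: (u n) (v n) => ? ? [].
Qed.

Lemma ccvgZ (a : C) u l : ccvg u l -> ccvg (fun n => a * u n) (a * l).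
Proof.
move=> [h1 h2]; split.
  have -> : complex.Re (a * l) = complex.Re a * complex.Re l - complex.Im a * complex.Im l.
    by case: a l {h1 h2} => ? ? [].
  rewrite (_ : (fun n => _) = (fun n => complex.Re a * complex.Re (u n) - complex.Im a * complex.Im (u n))).
    by apply: cvgB; apply: cvgMr.
  by apply/funext => n; case: a (u n) => ? ? [].
have -> : complex.Im (a * l) = complex.Re a * complex.Im l + complex.Im a * complex.Re l.
  by case: a l {h1 h2} => ? ? [].
rewrite (_ : (fun n => _) = (fun n => complex.Re a * complex.Im (u n) + complex.Im a * complex.Re (u n))).
  by apply: cvgD; apply: cvgMr.
by apply/funext => n; case: a (u n) => ? ? [].
Qed.

Lemma ccvg_sum (I : Type) (s : seq I) (u : I -> nat -> C) (l : I -> C) :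
  (forall i, ccvg (u i) (l i)) ->
  ccvg (fun n => \sum_(i <- s) u i n) (\sum_(i <- s) l i).
Proof.
move=> h; elim: s => [|i s IH].
  rewrite big_nil (_ : (fun n => _) = (fun=> 0)); first exact: ccvg_cst.
  by apply/funext => n; rewrite big_nil.
rewrite big_cons (_ : (fun n => _) = (fun n => u i n + \sum_(i <- s) u i n)).
  exact: ccvgD.
by apply/funext => n; rewrite big_cons.
Qed.

Lemma ccvg_nsq u l : ccvg u l -> (fun n => nsq (u n)) @ \oo --> nsq l.
Proof. by move=> [h1 h2]; rewrite /nsq; apply: cvgD; apply: cvgM. Qed.

(** Absolute convergence of the telescoping series. *)
Lemma cvg_geometric_steps (v : nat -> R) (c r : R) : 0 <= r -> r < 1 ->
  (forall n, `|v n.+1 - v n| <= c * r ^+ n) -> cvgn v.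
Proof.
move=> r0 r1 h.
have E : v = (fun n => v 0%N + series (telescope v) n).
  by apply/funext => n; rewrite -eq_sum_telescope.
rewrite E; apply: is_cvgD; first exact: is_cvg_cst.
apply: normed_cvg; apply: (@series_le_cvg _ _ (geometric c r)).
- by move=> n; apply: normr_ge0.
- by move=> n; apply: le_trans (h n).
- by move=> n; apply: h.
- by apply: is_cvg_geometric_series; rewrite ger0_norm.
Qed.

Lemma ccvg_geometric_steps u (K r : R) : 0 <= r -> r < 1 ->
  (forall n, nsq (u n.+1 - u n) <= K * r ^+ n) -> exists l, ccvg u l.
Proof.
move=> r0 r1 h.
have K0 : 0 <= K by have := h 0%N; rewrite expr0 mulr1; apply: le_trans; exact: nsq_ge0.
have root_lt1 : Num.sqrt r < 1 by rewrite -sqrtr1 ltr_sqrt.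
have step (x : R) n : x ^+ 2 <= K * r ^+ n -> `|x| <= Num.sqrt K * Num.sqrt r ^+ n.
  move=> hx; rewrite -(@ler_pXn2r _ 2) ?nnegrE ?mulr_ge0 ?exprn_ge0 ?sqrtr_ge0 //.
  by rewrite -normrX ger0_norm ?sqr_ge0 // exprMn -exprM mulnC exprM !sqr_sqrtr.
have re n : `|complex.Re (u n.+1) - complex.Re (u n)| <= Num.sqrt K * Num.sqrt r ^+ n.
  apply: step; apply: le_trans (h n); rewrite /nsq.
  by case: (u n.+1) (u n) => ? ? [? ?] /=; rewrite lerDl sqr_ge0.
have im n : `|complex.Im (u n.+1) - complex.Im (u n)| <= Num.sqrt K * Num.sqrt r ^+ n.
  apply: step; apply: le_trans (h n); rewrite /nsq.
  by case: (u n.+1) (u n) => ? ? [? ?] /=; rewrite lerDr sqr_ge0.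
have /cvg_ex[a ha] := cvg_geometric_steps (sqrtr_ge0 r) root_lt1 re.
have /cvg_ex[b hb] := cvg_geometric_steps (sqrtr_ge0 r) root_lt1 im.
by exists (Complex a b).
Qed.

Lemma ccvg0_geometric u (K r : R) : 0 <= r -> r < 1 ->
  (forall n, nsq (u n) <= K * r ^+ n) -> ccvg u 0.
Proof.
move=> r0 r1 h; have [l hl] : exists l, ccvg u l.
  apply: (@ccvg_geometric_steps _ (4 * K) r) => // n.
  have := nsqD (u n.+1) (-1 * u n) ltr01; rewrite mulN1r => /le_trans; apply.
  rewrite -mulN1r nsqM (_ : nsq (-1) = 1); last first.
    by rewrite /nsq /= oppr0 expr0n /= addr0 sqrrN expr1n.
  have K0 : 0 <= K * r ^+ n by apply: le_trans (h n); exact: nsq_ge0.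
  have := h n; have := h n.+1; have : K * r ^+ n.+1 <= K * r ^+ n.
    by rewrite exprS mulrCA ler_piMl // ltW.
  by rewrite invr1; lra.
suff -> : 0 = l by [].
apply/esym/nsq_eq0/(cvg_unique _ (ccvg_nsq hl)) => //.
apply: (@squeeze_cvgr _ _ _ _ (fun=> 0) (fun n => K * r ^+ n)).
- by near=> n; rewrite nsq_ge0 h.
- exact: cvg_cst.
- have -> : 0 = K * 0 by rewrite mulr0.
  by apply: cvgMr; apply: cvg_expr; rewrite ger0_norm.
Unshelve. all: by end_near.
Qed.

Lemma bnd_ccvg (V : choiceType) (u : nat -> V -> C) (f : V -> C) K :
  (forall x, ccvg (fun n => u n x) (f x)) -> (forall n, bnd (u n) K) -> bnd f K.
Proof.
move=> h hK s us.
have lim_s : (fun n => \sum_(x <- s) nsq (u n x)) @ \oo --> \sum_(x <- s) nsq (f x).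
  elim: {us} s => [|x s IH].
    rewrite big_nil (_ : (fun n => _) = (fun=> 0)); first exact: cvg_cst.
    by apply/funext => n; rewrite big_nil.
  rewrite big_cons (_ : (fun n => _) = (fun n => nsq (u n x) + \sum_(y <- s) nsq (u n y))).
    by apply: cvgD => //; apply: ccvg_nsq.
  by apply/funext => n; rewrite big_cons.
apply: (cvgr_to_le lim_s).
by near=> n; apply: hK.
Unshelve. all: by end_near.
Qed.

End ComplexLimits.

Section Neumann.
Variables (R : realType) (V : choiceType).
Local Notation C := R[i].
Variables (W : (V -> C) -> V -> C) (r : R).
Hypothesis r0 : 0 < r.
Hypothesis r1 : r < 1.
Hypothesis W_lin : forall (a : C) f g,
  W (fun x => a * f x + g x) = (fun x => a * W f x + W g x).
Hypothesis W_bnd : forall f K, bnd f K -> bnd (W f) (r * K).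
Hypothesis W_cvg : forall (u : nat -> V -> C) f, (forall x, ccvg (fun n => u n x) (f x)) ->
  forall x, ccvg (fun n => W (u n) x) (W f x).
Implicit Types f g h : V -> C.

(** The partial sums [h + W h + ... + W^(n-1) h]. *)
Fixpoint neumann n h : V -> C :=
  if n is n'.+1 then fun x => W (neumann n' h) x + h x else fun=> 0.

Let W0 : W (fun=> 0) = fun=> 0.
Proof.
have := W_lin (-1) (fun=> 0) (fun=> 0).
rewrite (_ : (fun x => _) = (fun=> 0)); last by apply/funext => x; rewrite mulr0 addr0.
by move=> ->; apply/funext => x; rewrite mulN1r addNr.
Qed.

Let W_iter_bnd f K n : bnd f K -> bnd (iter n W f) (K * r ^+ n).
Proof.
move=> hf; elim: n => [|n IH] /=; first by rewrite mulr1.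
by rewrite exprS mulrCA; apply: W_bnd.
Qed.

Let neumann_step n h x : neumann n.+1 h x - neumann n h x = iter n W h x.
Proof.
elim: n x => [|n IH] x /=; first by rewrite W0 add0r subr0.
rewrite opprD addrACA subrr addr0.
rewrite (_ : (fun x => _) = fun x => 1 * iter n W h x + neumann n h x).
  by rewrite W_lin mul1r addrK.
by apply/funext => y; rewrite mul1r -IH subrK.
Qed.

Let neumann_lin n (a : C) f g :
  neumann n (fun x => a * f x + g x) = (fun x => a * neumann n f x + neumann n g x).
Proof.
elim: n => [|n IH] /=; apply/funext => x; first by rewrite mulr0 addr0.
by rewrite IH W_lin; ring.
Qed.

Let neumann_telescope n f :
  neumann n (fun x => W f x - f x) = (fun x => iter n W f x - f x).
Proof.
elim: n => [|n IH] /=; apply/funext => x; first by rewrite subrr.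
have -> : neumann n (fun x => W f x - f x) = fun x => -1 * f x + iter n W f x.
  by rewrite IH; apply/funext => y; rewrite mulN1r addrC.
by rewrite W_lin; ring.
Qed.

(* With these constants [(1 + t) * r = s < 1], so that a bound [M * K] on one partial
   sum gives the same bound on the next one. *)
Let s := (1 + r) / 2.
Let t := (s - r) / r.
Let M := (1 + t^-1) / (1 - s).

Let M_ge0 : 0 <= M.
Proof.
have t0 : 0 <= t by rewrite /t /s; apply: divr_ge0; [have := r1; lra | exact: ltW].
apply: divr_ge0; last by rewrite /s; have := r1; lra.
by rewrite addr_ge0 // invr_ge0.
Qed.

Let neumann_bnd n h K : bnd h K -> bnd (neumann n h) (M * K).
Proof.
move=> hh; have K0 := bnd_ge0 hh.
have s1 : 0 < 1 - s by rewrite /s; have := r1; lra.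
have sr : 0 < s - r by rewrite /s; have := r1; lra.
have t0 : 0 < t by rewrite /t divr_gt0.
have ti : 0 < t^-1 by rewrite invr_gt0.
elim: n => [|n IH] /=.
  move=> l ul; rewrite big1; first exact: mulr_ge0 M_ge0 K0.
  by move=> x _; rewrite /nsq /= expr0n addr0.
have := bnd_lin 1 t0 (W_bnd IH) hh.
rewrite (_ : (fun x => 1 * _ + _) = fun x => W (neumann n h) x + h x); last first.
  by apply/funext => x; rewrite mul1r.
apply: bnd_le.
have -> : nsq (1 : C) = 1 by rewrite /nsq /= expr0n addr0 expr1n.
have -> : (1 + t) * (1 * (r * (M * K))) = s * (M * K).
  by rewrite /t; field; rewrite gt_eqF.
have -> : (1 + t^-1) * K = (1 - s) * (M * K).
  rewrite /M; field; rewrite (gt_eqF t0) /=; move: s1; rewrite subr_gt0 => s1.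
  by rewrite subr_eq0 gt_eqF.
lra.
Qed.

Let neumann_cvg h : l2 h -> forall x, exists l, ccvg (fun n => neumann n h x) l.
Proof.
move=> /bnd_l2norm hh x.
apply: (@ccvg_geometric_steps _ _ (l2norm h ^+ 2) r) => //; first exact: ltW.
by move=> n; rewrite neumann_step; apply: bnd_point; apply: W_iter_bnd.
Qed.

Definition neumann_sum h (x : V) : C := xget 0 [set l | ccvg (fun n => neumann n h x) l].

Let neumann_sumP h : l2 h -> forall x, ccvg (fun n => neumann n h x) (neumann_sum h x).
Proof.
move=> lh x; rewrite /neumann_sum; case: xgetP => [l _ //|no].
by have [l hl] := neumann_cvg lh x; case: (no l).
Qed.

Let neumann_sumE h x l : ccvg (fun n => neumann n h x) l -> neumann_sum h x = l.
Proof.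
move=> hl; rewrite /neumann_sum; case: xgetP => [k _ /= hk|/(_ l)//].
exact: ccvg_unique hk hl.
Qed.

(** As [A - z] is [k * (W - 1)], it is inverted by [- k^-1] times the Neumann
    series of [W]. *)
Lemma neumann_inverse (A : (V -> C) -> V -> C) (z k : C) : k != 0 ->
  (forall f x, A f x - z * f x = k * (W f x - f x)) -> ~ spectrum A z.
Proof.
move=> k0 AE; move=> zs; apply: zs.
exists (fun h x => - k^-1 * neumann_sum h x).
  split.
  - move=> f lf; have hf := bnd_l2norm lf.
    exact: (bnd_l2 (bnd_scale (- k^-1) (bnd_ccvg (neumann_sumP lf) (fun n => neumann_bnd n hf)))).
  - move=> a f g lf lg; apply/funext => x.
    rewrite (@neumann_sumE _ _ (a * neumann_sum f x + neumann_sum g x)); first by ring.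
    rewrite (_ : (fun n => _) = fun n => a * neumann n f x + neumann n g x).
      by apply: ccvgD; [apply: ccvgZ|]; apply: neumann_sumP.
    by apply/funext => n; rewrite neumann_lin.
  - exists (Num.sqrt (nsq (- k^-1) * M)) => f lf; have hf := bnd_l2norm lf.
    have hb := bnd_scale (- k^-1) (bnd_ccvg (neumann_sumP lf) (fun n => neumann_bnd n hf)).
    have n0 := l2norm_ge0 f.
    apply: l2norm_le; first by rewrite mulr_ge0 ?sqrtr_ge0.
    rewrite exprMn sqr_sqrtr; first by rewrite -(mulrA _ M).
    exact: mulr_ge0 (nsq_ge0 _) M_ge0.
move=> f lf; split; apply/funext => x.
  have -> : (fun x => A f x - z * f x) = fun x => k * (W f x - f x) + 0.
    by apply/funext => y; rewrite AE addr0.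
  rewrite (@neumann_sumE _ _ (k * (0 - f x))); first by field.
  rewrite (_ : (fun n => _) = fun n => k * (iter n W f x + - f x)).
    apply: ccvgZ; apply: ccvgD; last exact: ccvg_cst.
    apply: (@ccvg0_geometric _ _ (l2norm f ^+ 2) r) => //; first exact: ltW.
    by move=> n; apply: bnd_point; apply: W_iter_bnd; apply: bnd_l2norm.
  apply/funext => n; rewrite (neumann_lin n k (fun x => W f x - f x) (fun=> 0)).
  rewrite neumann_telescope; set z0 := neumann n _ x.
  suff -> : z0 = 0 by rewrite addr0.
  have := neumann_lin n (-1) (fun=> 0) (fun=> 0).
  rewrite (_ : (fun x => _) = (fun=> 0)); last by apply/funext => y; rewrite mulr0 addr0.
  by move=> /(congr1 (fun F => F x)); rewrite mulN1r addNr.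
rewrite AE.
have -> : W (fun x => - k^-1 * neumann_sum f x) x = - k^-1 * W (neumann_sum f) x.
  have := W_lin (- k^-1) (neumann_sum f) (fun=> 0).
  rewrite W0 => /(congr1 (fun F => F x)); rewrite addr0 => <-.
  by congr (W _ x); apply/funext => y; rewrite addr0.
have : neumann_sum f x = W (neumann_sum f) x + f x.
  apply: neumann_sumE; have := ccvgD (W_cvg (neumann_sumP lf) x) (ccvg_cst (f x)).
  by move=> [h1 h2]; split; rewrite -cvg_shiftS.
by move=> ->; field.
Qed.

End Neumann.

(** * Approximate eigenvalues and resolvent set *)

Section ApproximateEigenvalues.
Variables (R : realType) (V : choiceType).

(** An inverse of norm [M] would give [norm f <= M * |w - z| * norm f] for every
    eigenvector [f] with eigenvalue [w]. *)
Lemma approximate_eigenvalue (A : (V -> R[i]) -> V -> R[i]) (z : R[i]) :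
  (forall eps : R, 0 < eps -> exists2 w, eigenvalues A w & nsq (w - z) < eps) ->
  spectrum A z.
Proof.
move=> h [B [_ _ [M hM]] hB].
have [|w [f [lf f0 Af]] wz] := h (M ^+ 2 + 1)^-1.
  by rewrite invr_gt0 ltr_wpDl ?sqr_ge0.
have [+ _] := hB f lf.
have -> : (fun x => A f x - z * f x) = (fun x => (w - z) * f x).
  by apply/funext => x; rewrite Af; ring.
set g := (fun x => (w - z) * f x) => Bg.
have n0 := l2norm_gt0 lf f0.
have bg : bnd g (nsq (w - z) * l2norm f ^+ 2) by apply/bnd_scale/bnd_l2norm.
have lg := bnd_l2 bg.
have ng : l2norm g ^+ 2 <= nsq (w - z) * l2norm f ^+ 2.
  have k0 : 0 <= nsq (w - z) * l2norm f ^+ 2 by rewrite mulr_ge0 ?nsq_ge0 ?sqr_ge0.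
  rewrite -[leRHS]sqr_sqrtr // ler_pXn2r ?nnegrE ?sqrtr_ge0 ?l2norm_ge0 //.
  by apply: l2norm_le; rewrite ?sqrtr_ge0 // sqr_sqrtr.
have := hM g lg; rewrite Bg => fM.
have : l2norm f ^+ 2 <= M ^+ 2 * l2norm g ^+ 2.
  rewrite -exprMn -[leRHS]real_normK ?num_real // ler_pXn2r ?nnegrE ?(ltW n0) //.
  exact: le_trans fM (ler_norm _).
have M1 : 0 < M ^+ 2 + 1 by rewrite ltr_wpDl ?sqr_ge0.
have : nsq (w - z) * (M ^+ 2 + 1) < 1 by rewrite -ltr_pdivlMr // div1r.
have F0 : 0 < l2norm f ^+ 2 by rewrite exprn_gt0.
have := sqr_ge0 M; have := nsq_ge0 (w - z).
move: (nsq (w - z)) (M ^+ 2) (l2norm f ^+ 2) (l2norm g ^+ 2) ng F0 => a m F G; nra.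
Qed.

End ApproximateEigenvalues.

Section ResolventSet.
Variables (R : realType) (V Z : choiceType) (u : 'I_3 -> V -> Z) (q : nat).
Hypothesis fibre : forall i z (s : seq V), uniq s -> (count (fun y => u i y == z) s <= q)%N.
Hypothesis q0 : (0 < q)%N.
Variable nb : V -> seq V.
Hypothesis nb_uniq : forall x, uniq (nb x).
Hypothesis nb_adj : forall x y, (y \in nb x)%:R = lab_adj R u x y.
Variable P : (V -> R[i]) -> V -> R[i].
Hypothesis P_sum : forall f x, P f x = (6 * q)%:R^-1 * \sum_(y <- nb x) f y.

Let sum_nb (s : seq V) x (g : V -> R) : uniq s -> {subset nb x <= s} ->
  \sum_(y <- nb x) g y = \sum_(y <- s) lab_adj R u x y * g y.
Proof.
move=> us sub; rewrite (perm_big [seq y <- s | y \in nb x]) /=.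
  rewrite big_filter big_mkcond; apply: eq_bigr => y _.
  by rewrite -nb_adj; case: ifP; rewrite ?mul1r ?mul0r.
apply: uniq_perm; rewrite ?filter_uniq // => y; rewrite mem_filter.
by case: (boolP (y \in nb x)) => // /sub ->.
Qed.

Let ReP f x : complex.Re (P f x) = (6 * q)%:R^-1 * \sum_(y <- nb x) complex.Re (f y).
Proof.
rewrite P_sum; have -> : (6 * q)%:R^-1 = (real_complex R (6 * q)%:R^-1).
  by rewrite fmorphV rmorph_nat.
have -> : \sum_(y <- nb x) complex.Re (f y) = complex.Re (\sum_(y <- nb x) f y).
  elim: (nb x) => [|y s IH]; rewrite ?big_nil // !big_cons IH.
  by case: (f y) (\sum_(j <- s) f j) => ? ? [].
by case: (\sum_(y <- nb x) f y) => ? ? /=; rewrite mul0r subr0.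
Qed.

Let ImP f x : complex.Im (P f x) = (6 * q)%:R^-1 * \sum_(y <- nb x) complex.Im (f y).
Proof.
rewrite P_sum; have -> : (6 * q)%:R^-1 = (real_complex R (6 * q)%:R^-1).
  by rewrite fmorphV rmorph_nat.
have -> : \sum_(y <- nb x) complex.Im (f y) = complex.Im (\sum_(y <- nb x) f y).
  elim: (nb x) => [|y s IH]; rewrite ?big_nil // !big_cons IH.
  by case: (f y) (\sum_(j <- s) f j) => ? ? [].
by case: (\sum_(y <- nb x) f y) => ? ? /=; rewrite mul0r addr0.
Qed.

(** On real and imaginary parts the operator [P - 1/4] has norm at most 3/4, and the
    cross terms with the imaginary shift [b] cancel by symmetry. *)
Lemma centred_bnd (b : R) f K : bnd f K ->
  bnd (fun x => P f x - Complex 4^-1 b * f x) (((3 / 4) ^+ 2 + b ^+ 2) * K).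
Proof.
move=> hf s us; pose s' := undup (s ++ flatten (map nb s)).
have us' : uniq s' by apply: undup_uniq.
have ss' : {subset s <= s'} by move=> x xs; rewrite mem_undup mem_cat xs.
have nbs x : x \in s -> {subset nb x <= s'}.
  move=> xs y yn; rewrite mem_undup mem_cat; apply/orP; right.
  by apply/flatten_mapP; exists x.
pose X g x : R := (6 * q)%:R^-1 * \sum_(y <- s') lab_adj R u x y * g y - 4^-1 * g x.
pose fr x := complex.Re (f x); pose fi x := complex.Im (f x).
have E x : x \in s -> nsq (P f x - Complex 4^-1 b * f x) =
    (X fr x + b * fi x) ^+ 2 + (X fi x - b * fr x) ^+ 2.
  move=> xs.
  have Er : X fr x = complex.Re (P f x) - 4^-1 * fr x by rewrite ReP /X -(sum_nb _ us' (nbs x xs)).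
  have Ei : X fi x = complex.Im (P f x) - 4^-1 * fi x by rewrite ImP /X -(sum_nb _ us' (nbs x xs)).
  rewrite Er Ei /fr /fi /nsq.
  by case: (P f x) (f x) => ? ? [? ?] /=; congr (_ ^+ 2 + _ ^+ 2); ring.
rewrite big_seq; under eq_bigr => x xs do rewrite E //; rewrite -big_seq.
apply: le_trans (ler_sum_sub us us' ss' _) _.
  by move=> x; rewrite addr_ge0 ?sqr_ge0.
have cross : \sum_(x <- s') (fi x * X fr x - fr x * X fi x) = 0.
  have sym g h : \sum_(x <- s') g x * X h x = \sum_(x <- s') \sum_(y <- s')
      (6 * q)%:R^-1 * lab_adj R u x y * (g x * h y) - 4^-1 * \sum_(x <- s') g x * h x.
    rewrite mulr_sumr -sumrB; apply: eq_bigr => x _.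
    rewrite /X mulrBr; congr (_ - _); last by ring.
    by rewrite !mulr_sumr; apply: eq_bigr => y _; ring.
  rewrite sumrB (_ : \sum_(x <- s') fi x * X fr x = \sum_(x <- s') fr x * X fi x) ?subrr //.
  rewrite !sym exchange_big /=; congr (_ - _ * _); apply: eq_bigr => x _.
    by apply: eq_bigr => y _; rewrite lab_adj_sym (mulrC (fi y)).
  by rewrite mulrC.
have -> : \sum_(x <- s') ((X fr x + b * fi x) ^+ 2 + (X fi x - b * fr x) ^+ 2) =
   \sum_(x <- s') X fr x ^+ 2 + \sum_(x <- s') X fi x ^+ 2 +
   b ^+ 2 * (\sum_(x <- s') fr x ^+ 2 + \sum_(x <- s') fi x ^+ 2) +
   2 * b * \sum_(x <- s') (fi x * X fr x - fr x * X fi x).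
  rewrite -!big_split !mulr_sumr -!big_split; apply: eq_bigr => x _ /=; ring.
rewrite cross mulr0 addr0.
have hK : \sum_(x <- s') fr x ^+ 2 + \sum_(x <- s') fi x ^+ 2 <= K.
  by have := hf s' us'; rewrite /nsq big_split.
have nr : \sum_(x <- s') X fr x ^+ 2 <= (3 / 4) ^+ 2 * \sum_(x <- s') fr x ^+ 2.
  exact: centred_norm.
have ni : \sum_(x <- s') X fi x ^+ 2 <= (3 / 4) ^+ 2 * \sum_(x <- s') fi x ^+ 2.
  exact: centred_norm.
apply: (@le_trans _ _ (((3 / 4) ^+ 2 + b ^+ 2) *
   (\sum_(x <- s') fr x ^+ 2 + \sum_(x <- s') fi x ^+ 2))); first by lra.
by apply: ler_wpM2l => //; rewrite addr_ge0 ?sqr_ge0.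
Qed.

(** Some disk with centre [c = 1/4 + ib] contains the interval and not [z]; then
    [(P - c) / (z - c)] is a contraction, whose Neumann series inverts [P - z]. *)
Lemma spectrum_subset z : spectrum P z -> [set x%:C%C | x in `[- 2^-1, 1]] z.
Proof.
move=> zs; apply: contrapT => zI; move: zs.
case: z zI => x y zI.
have [b hb] : exists b : R, (3 / 4) ^+ 2 + b ^+ 2 < nsq (Complex x y - Complex 4^-1 b).
  have E b : nsq (Complex x y - Complex 4^-1 b) = (x - 4^-1) ^+ 2 + (y - b) ^+ 2 by [].
  have [y0|y0] := eqVneq y 0.
    exists 0; rewrite E y0 subr0 expr0n /= !addr0.
    have : x < - 2^-1 \/ 1 < x.
      have [h1|h1] := ltP x (- 2^-1); first by left.
      have [h2|h2] := ltP 1 x; first by right.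
      by exfalso; apply: zI; exists x; rewrite ?y0 //= in_itv /= h1 h2.
    by case=> h; nra.
  (* with this b the mixed term of (y - b) ^ 2 is 2, which exceeds 9/16 *)
  exists (- y^-1); rewrite E.
  have -> : (y - - y^-1) ^+ 2 = y ^+ 2 + 2 + (- y^-1) ^+ 2 by field.
  have := sqr_ge0 (x - 4^-1); have := sqr_ge0 y; lra.
set c := Complex 4^-1 b in hb; set z := Complex x y in hb *.
have k0 : 0 < nsq (z - c) by apply: le_lt_trans hb; rewrite addr_ge0 ?sqr_ge0.
have kN : z - c != 0.
  by apply/eqP => E; move: k0; rewrite E /nsq /= expr0n addr0 ltxx.
pose W f x := (z - c)^-1 * (P f x - c * f x).
have Vnsq : nsq (z - c)^-1 = (nsq (z - c))^-1.
  by rewrite -!normc_nsq Normc.normcV exprVn.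
suff: ~ spectrum P z by [].
apply: (@neumann_inverse _ _ W (((3 / 4) ^+ 2 + b ^+ 2) / nsq (z - c)) _ _ _ _ _ P z (z - c)).
- by rewrite divr_gt0 // ltr_wpDr ?sqr_ge0 // exprn_gt0 //; lra.
- by rewrite ltr_pdivrMr // mul1r.
- move=> a f g; apply/funext => v; rewrite /W !P_sum big_split /= -mulr_sumr; ring.
- move=> f K hf; have := bnd_scale (z - c)^-1 (centred_bnd b hf).
  by apply: bnd_le; rewrite Vnsq mulrCA mulrA.
- move=> w f h v; apply: ccvgZ; apply: ccvgD.
    rewrite P_sum (_ : (fun n => _) = fun n => (6 * q)%:R^-1 * \sum_(y <- nb v) w n y).
      by apply: ccvgZ; apply: ccvg_sum.
    by apply/funext => n; rewrite P_sum.
  rewrite -mulN1r mulrA (_ : (fun n => _) = fun n => -1 * c * w n v); first exact: ccvgZ.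
  by apply/funext => n; rewrite mulN1r mulNr.
- by [].
- by move=> f v; rewrite /W; field.
Qed.

End ResolventSet.

(** * Moves in a horocyclic product of three trees *)

Section HorocyclicMoves.
Variables (T : choiceType) (par : T -> T) (h : T -> int) (ch : T -> seq T) (q : nat).
Hypothesis h_par : forall x, h (par x) = h x - 1.
Hypothesis ch_uniq : forall x, uniq (ch x).
Hypothesis ch_size : forall x, size (ch x) = q.
Hypothesis mem_ch : forall x y, (y \in ch x) = (par y == x).

Local Notation X := {ffun 'I_3 -> T}.
Implicit Types x y : X.

Definition upd x (i : 'I_3) (a : T) : X := [ffun k => if k == i then a else x k].
Definition up (i : 'I_3) x : X := upd x i (par (x i)).
Definition level x : int := \sum_(i < 3) h (x i).

Definition moves x : seq X :=
  [seq upd (up p.1 x) p.2 c |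
     p <- [seq p <- enum {: 'I_3 * 'I_3} | p.1 != p.2], c <- ch (x p.2)].

Lemma level_upd x i a : level (upd x i a) = level x - h (x i) + h a.
Proof.
rewrite /level (bigD1 i) //= [in RHS](bigD1 i) //= ffunE eqxx.
rewrite (eq_bigr (fun k => h (x k))) => [|k /negbTE ki]; first by ring.
by rewrite ffunE ki.
Qed.

Lemma up_eqP i j x y : i != j -> reflect (exists2 c, c \in ch (x j) & y = upd (up i x) j c)
  (up i x == up j y).
Proof.
move=> ij; apply: (iffP eqP) => [E|[c cj ->]].
  exists (y j).
    by rewrite mem_ch; have := congr1 (fun f : X => f j) E; rewrite !ffunE eqxx eq_sym (negbTE ij) => ->.
  apply/ffunP => k; have := congr1 (fun f : X => f k) E; rewrite !ffunE.
  by case: (eqVneq k j) => [->|] //.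
apply/ffunP => k; rewrite !ffunE eqxx; case: (eqVneq k j) => [->|_] //.
by rewrite eq_sym (negbTE ij); move: cj; rewrite mem_ch => /eqP ->.
Qed.

(** Two triples are neighbours when raising one coordinate of the first and another
    coordinate of the second gives the same triple. *)
Lemma mem_movesP x y : reflect (exists i j, i != j /\ up i x = up j y) (y \in moves x).
Proof.
apply: (iffP allpairsPdep) => [[[i j] [c [/= hp cj ->]]]|[i [j [ij /eqP/(up_eqP _ _ ij)[c cj ->]]]]].
  move: hp; rewrite mem_filter => /andP[/= ij _].
  by exists i, j; split=> //; apply/eqP/(up_eqP _ _ ij); exists c.
by exists (i, j), c; split=> //; rewrite mem_filter /= ij mem_enum.
Qed.

Lemma up_eq_height i j x y : i != j -> up i x = up j y ->
  [/\ h (y i) = h (x i) - 1, h (y j) = h (x j) + 1 &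
      forall k, k != i -> k != j -> y k = x k].
Proof.
move=> ij E; have at_ k := congr1 (fun f : X => f k) E.
split.
- by have := at_ i; rewrite !ffunE eqxx (negbTE ij) => <-; rewrite h_par.
- have := at_ j; rewrite !ffunE eqxx eq_sym (negbTE ij) => E2.
  by rewrite E2 h_par subrK.
- by move=> k /negbTE ki /negbTE kj; have := at_ k; rewrite !ffunE ki kj.
Qed.

(** The raised coordinates are those in which the heights differ. *)
Lemma up_eq_unique i j i' j' x y : i != j -> i' != j' ->
  up i x = up j y -> up i' x = up j' y -> i = i' /\ j = j'.
Proof.
move=> ij ij' /(up_eq_height ij)[a1 a2 a3] /(up_eq_height ij')[b1 b2 b3]; split.
  apply/eqP/contraT => ii'; have [E|N] := eqVneq i j'.
    by move: b2; rewrite -E a1; lia.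
  by have := b3 _ ii' N; move=> E; move: a1; rewrite E; lia.
apply/eqP/contraT => jj'; have [E|N] := eqVneq j i'.
  by move: b1; rewrite -E a2; lia.
by have := b3 _ N jj'; move=> E; move: a2; rewrite E; lia.
Qed.

Lemma level_moves x y : y \in moves x -> level y = level x.
Proof.
move=> /mem_movesP[i [j [ij /eqP/(up_eqP _ _ ij)[c cj ->]]]].
rewrite level_upd /up level_upd ffunE eq_sym (negbTE ij) h_par.
by move: cj; rewrite mem_ch => /eqP <-; rewrite h_par; lia.
Qed.

Lemma moves_uniq x : uniq (moves x).
Proof.
apply: allpairs_uniq_dep => [|p _|]; first by rewrite filter_uniq ?enum_uniq.
  exact: ch_uniq.
move=> _ _ /allpairsPdep[[i j] [c [/= hp cj ->]]] /allpairsPdep[[i' j'] [c' [/= hp' cj' ->]]] /= E.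
move: hp hp'; rewrite !mem_filter => /andP[/= ij _] /andP[/= ij' _].
have e1 : up i x = up j (upd (up i x) j c) by apply/eqP/up_eqP => //; exists c.
have e2 : up i' x = up j' (upd (up i x) j c) by rewrite E; apply/eqP/up_eqP => //; exists c'.
have [Ei Ej] := up_eq_unique ij ij' e1 e2; subst i' j'.
by have := congr1 (fun f : X => f j) E; rewrite !ffunE eqxx => ->.
Qed.

Lemma sum_moves (R : nmodType) (F : X -> R) x :
  \sum_(y <- moves x) F y =
  \sum_i \sum_(j | j != i) \sum_(c <- ch (x j)) F (upd (up i x) j c).
Proof.
rewrite big_allpairs_dep /= big_filter big_enum_cond /= pair_big_dep /=.
by apply: eq_bigl => p; rewrite eq_sym.
Qed.

(** Triples with a given label differ only by the choice of a child. *)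
Lemma up_fibre i z (s : seq X) : uniq s -> (count (fun y => up i y == z) s <= q)%N.
Proof.
move=> us; rewrite -size_filter; set l := [seq y <- s | up i y == z].
have inj : {in l &, injective (fun y : X => y i)}.
  move=> y y'; rewrite !mem_filter => /andP[/eqP yz _] /andP[/eqP yz' _] E.
  apply/ffunP => k; have := congr1 (fun f : X => f k) (etrans yz (esym yz')).
  by rewrite !ffunE; case: (eqVneq k i) => [->|].
rewrite -(size_map (fun y : X => y i)) -(ch_size (z i)); apply: uniq_leq_size.
  by rewrite map_inj_in_uniq ?filter_uniq.
move=> _ /mapP[y + ->]; rewrite mem_filter mem_ch => /andP[/eqP <- _].
by rewrite !ffunE eqxx.
Qed.

Lemma lab_adj_moves (R : realType) x y : lab_adj R up x y = (y \in moves x)%:R.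
Proof.
rewrite /lab_adj; case: (boolP (y \in moves x)) => [/mem_movesP[i [j [ij E]]]|N].
  have ji : j != i by rewrite eq_sym.
  rewrite (bigD1 i) //= (bigD1 j) //= (introT eqP E) big1 => [|k /andP[ki kj]]; last first.
    case: eqP => // E'; rewrite eq_sym in ki.
    by have [_ jk] := up_eq_unique ij ki E E'; rewrite jk eqxx in kj.
  rewrite addr0 big1 ?addr0 // => i' ii'; apply: big1 => k ki; case: eqP => // E'.
  rewrite eq_sym in ki; have [jk _] := up_eq_unique ij ki E E'.
  by rewrite jk eqxx in ii'.
apply: big1 => i _; apply: big1 => j ji; case: eqP => // E.
by case/mem_movesP: N; exists i, j; rewrite eq_sym.
Qed.

Definition triple (a b c : T) : X := [ffun k : 'I_3 => nth c [:: a; b] k].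

Lemma tripleE x : x = triple (x 0) (x 1) (x 2).
Proof.
apply/ffunP => k; rewrite !ffunE; case: k => [[|[|[|//]]] hk] /=; congr (x _); exact: val_inj.
Qed.

Lemma level_triple a b c : level (triple a b c) = h a + h b + h c.
Proof. by rewrite /level !big_ord_recl big_ord0 !ffunE /= addr0 addrA. Qed.

Lemma triple_inj a b c a' b' c' : triple a b c = triple a' b' c' -> [/\ a = a', b = b' & c = c'].
Proof.
move=> E; have at_ k := congr1 (fun f : X => f k) E.
by split; [have := at_ 0|have := at_ 1|have := at_ 2]; rewrite !ffunE.
Qed.

Lemma sum_moves_triple (R : nmodType) (F : X -> R) a b c :
  \sum_(y <- moves (triple a b c)) F y =
  \sum_(b' <- ch b) F (triple (par a) b' c) + \sum_(c' <- ch c) F (triple (par a) b c') +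
  \sum_(a' <- ch a) F (triple a' (par b) c) + \sum_(c' <- ch c) F (triple a (par b) c') +
  \sum_(a' <- ch a) F (triple a' b (par c)) + \sum_(b' <- ch b) F (triple a b' (par c)).
Proof.
rewrite sum_moves !big_ord_recl big_ord0 /=.
rewrite !(big_mkcond (fun j => j != _)) /= !big_ord_recl !big_ord0 /=.
rewrite !ffunE /= !addr0 !add0r !addrA.
congr (_ + _ + _ + _ + _ + _); apply: eq_bigr => d _; congr F; apply/ffunP => k;
  by rewrite !ffunE; case: k => [[|[|[|//]]] hk].
Qed.

End HorocyclicMoves.

(** * The random walk on DL(q,q,q) *)

Section DiestelLeader.
Variables (R : realType) (T : choiceType) (e : rel T) (q : nat).
Hypothesis hT : homogeneous_tree e q.
Variables (omega : set (nat -> T)) (o : T).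
Hypothesis homega : is_end e omega.

Local Notation X := {ffun 'I_3 -> T}.
Local Notation par := (parent omega).
Local Notation h := (busemann e omega o).
Local Notation DL := (DL e omega o).

Definition children x : seq T := sval (cid (children_exist hT homega o x)).

Lemma children_uniq x : uniq (children x).
Proof. by rewrite /children; case: cid => s []. Qed.

Lemma children_size x : size (children x) = q.
Proof. by rewrite /children; case: cid => s []. Qed.

Lemma mem_children x y : (y \in children x) = (par y == x).
Proof. by rewrite /children; case: cid => s [? ? hs]; apply: hs. Qed.

Let h_par := busemann_parent hT homega o.
Local Notation moves := (moves par children).

Definition nb (v : DL) : seq DL := pmap insub (moves (val v)).

Lemma level_DL (v : DL) : level h (val v) = 0.
Proof. by case: v => x /= /eqP. Qed.

Lemma map_val_nb v : map val (nb v) = moves (val v).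
Proof.
rewrite /nb (pmap_filter (@insubK _ _ _)); apply/all_filterP/allP => y yv.
rewrite isSome_insub /=.
by rewrite -/(level h y) (level_moves h_par mem_children yv) level_DL.
Qed.

Lemma mem_nb v w : (w \in nb v) = (val w \in moves (val v)).
Proof. by rewrite -map_val_nb mem_map //; exact: val_inj. Qed.

Lemma nb_uniq v : uniq (nb v).
Proof.
rewrite -(map_inj_uniq val_inj) map_val_nb.
exact: (moves_uniq h_par children_uniq mem_children).
Qed.

(** Since the heights of a point sum to zero, one of the two moving coordinates goes to
    its parent and the other one to a child. *)
Lemma DL_adjP v w : DL_adj v w <-> w \in nb v.
Proof.
rewrite mem_nb; split=> [[i [j [ij ei ej vw]]]|/(mem_movesP mem_children)[i [j [ij E]]]].
  apply/(mem_movesP mem_children).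
  have same : h (val w i) - h (val v i) = h (val v j) - h (val w j).
    have := level_DL v; have := level_DL w.
    have ji : j != i by rewrite eq_sym.
    rewrite /level !(bigD1 i isT) /= !(bigD1 j ji) /=.
    have -> : \sum_(k < 3 | (k != i) && (k != j)) h (sval w k) =
        \sum_(k < 3 | (k != i) && (k != j)) h (sval v k).
      by apply: eq_bigr => k /andP[ki kj]; rewrite [sval v k](vw k ki kj).
    move: (h _) (h _) (h _) (h _) (\sum_(k < 3 | _) _) => a b c d S; lia.
  have swap k l : k != l -> par (val v k) = val w k -> par (val w l) = val v l ->
      (forall m, m != k -> m != l -> val v m = val w m) -> up par k (val v) = up par l (val w).
    move=> kl hk hl hm; apply/ffunP => m; rewrite !ffunE.
    case: (eqVneq m k) => [->|triple]; first by rewrite (negbTE kl).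
    by case: (eqVneq m l) => [->|ml] //; apply: hm.
  move: ei ej; rewrite !(adj_parentP hT homega) => /orP[]/eqP hi /orP[]/eqP hj.
  - by move: same; rewrite -hi -hj !h_par; lia.
  - by exists i, j; split=> //; apply: swap.
  - exists j, i; rewrite eq_sym; split=> //; apply: swap => //; rewrite 1?eq_sym //.
    by move=> m mj mi; apply: vw.
  - by move: same; rewrite -hi -hj !h_par; lia.
have at_ k := congr1 (fun f : X => f k) E.
exists i, j; split=> //; rewrite ?(adj_parentP hT homega).
- by have := at_ i; rewrite !ffunE eqxx (negbTE ij) => ->; rewrite eqxx.
- by have := at_ j; rewrite !ffunE eqxx eq_sym (negbTE ij) => ->; rewrite eqxx orbT.
- by move=> k /negbTE ki /negbTE kj; have := at_ k; rewrite !ffunE ki kj.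
Qed.

Lemma srw_nb (f : DL -> R[i]) v :
  srw q f v = (6 * q)%:R^-1 * \sum_(w <- nb v) f w.
Proof.
rewrite /srw (_ : [set y | DL_adj v y] = [set` nb v]).
  by rewrite -fsbig_seq ?nb_uniq.
by apply/seteqP; split=> w /= /DL_adjP.
Qed.

Lemma srw_val (F : X -> R[i]) v :
  srw q (fun v : DL => F (val v)) v = (6 * q)%:R^-1 * \sum_(y <- moves (val v)) F y.
Proof. by rewrite srw_nb -map_val_nb big_map. Qed.

Let DL_fibre i z (s : seq DL) : uniq s -> (count (fun y => up par i (val y) == z) s <= q)%N.
Proof.
move=> us; have := up_fibre children_size mem_children i z.
move=> /(_ (map val s)); rewrite count_map; apply.
by rewrite map_inj_uniq //; exact: val_inj.
Qed.

Lemma srw_spectrum_subset z : (0 < q)%N ->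
  spectrum (@srw T e omega o R q) z -> [set x%:C%C | x in `[- 2^-1, 1]] z.
Proof.
move=> q0; apply: (spectrum_subset DL_fibre q0 nb_uniq) => [v w|]; last exact: srw_nb.
by rewrite mem_nb -(lab_adj_moves h_par mem_children).
Qed.

Let nb_sym v w : (v \in nb w) = (w \in nb v).
Proof.
have := lab_adj_sym R (up par) (val w) (val v).
rewrite !(lab_adj_moves h_par mem_children) -!mem_nb.
by do 2![case: (_ \in _)] => // /eqP; rewrite ?oner_eq0 // eq_sym oner_eq0.
Qed.

(** Symmetry of the transition matrix; as [f] has finite support, only finite sums
    occur, and [F] is arbitrary. *)
Lemma eigenfunctions_orthogonal (F f : DL -> R[i]) (z w : R[i]) (s : seq DL) :
  z != w -> srw q F = (fun v => z * F v) -> srw q f = (fun v => w * f v) ->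
  uniq s -> (forall v, v \notin s -> f v = 0) -> \sum_(v <- s) F v * f v = 0.
Proof.
move=> zw PF Pf us supp; pose s' := undup (s ++ flatten (map nb s)).
have us' : uniq s' by apply: undup_uniq.
have ss' : {subset s <= s'} by move=> x xs; rewrite mem_undup mem_cat xs.
have nbs x : x \in s -> {subset nb x <= s'}.
  move=> xs y yn; rewrite mem_undup mem_cat; apply/orP; right.
  by apply/flatten_mapP; exists x.
have sub_sum (l l' : seq DL) (G : DL -> R[i]) : uniq l -> uniq l' -> {subset l <= l'} ->
    \sum_(v <- l) G v = \sum_(v <- l') (v \in l)%:R * G v.
  move=> ul ul' ll'; rewrite (perm_big [seq v <- l' | v \in l]) /=.
    rewrite big_filter big_mkcond; apply: eq_bigr => v _.
    by case: ifP; rewrite ?mul1r ?mul0r.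
  apply: uniq_perm; rewrite ?filter_uniq // => v; rewrite mem_filter.
  by case: (boolP (v \in l)) => // /ll' ->.
have S1 : \sum_(v <- s') F v * srw q f v = w * \sum_(v <- s) F v * f v.
  rewrite (sub_sum s s') // mulr_sumr; apply: eq_bigr => v _; rewrite Pf.
  case: (boolP (v \in s)) => [_|/supp ->]; first by rewrite mul1r; ring.
  by rewrite !mulr0.
have S2 : \sum_(v <- s') F v * srw q f v = z * \sum_(v <- s) F v * f v.
  transitivity (\sum_(v <- s) srw q F v * f v); last first.
    by rewrite PF mulr_sumr; apply: eq_bigr => v _; rewrite mulrA.
  transitivity (\sum_(v <- s') \sum_(y <- s) (6 * q)%:R^-1 * (y \in nb v)%:R * (F v * f y)).
    apply: eq_bigr => v _; rewrite srw_nb mulrCA mulr_sumr mulr_sumr.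
    rewrite (sub_sum (nb v) (undup (nb v ++ s))) ?nb_uniq ?undup_uniq //; last first.
      by move=> y yn; rewrite mem_undup mem_cat yn.
    rewrite [RHS](sub_sum s (undup (nb v ++ s))) ?undup_uniq //; last first.
      by move=> y yn; rewrite mem_undup mem_cat yn orbT.
    apply: eq_bigr => y _; case: (boolP (y \in s)) => [_|/supp ->]; first by rewrite mul1r; ring.
    by rewrite !mulr0.
  rewrite exchange_big /= big_seq [RHS]big_seq; apply: eq_bigr => y ys.
  rewrite srw_nb (sub_sum _ s') ?nb_uniq //; last exact: nbs.
  rewrite mulr_sumr mulr_suml; apply: eq_bigr => v _; rewrite nb_sym; ring.
have : (z - w) * \sum_(v <- s) F v * f v = 0 by rewrite mulrBl -S1 -S2 subrr.
by move/eqP; rewrite mulf_eq0 subr_eq0 (negbTE zw) => /eqP.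
Qed.

End DiestelLeader.

(** * Antisymmetric sums of characters *)

Section AntisymmetricSums.
Variables (C : fieldType) (E : int -> C).
Hypothesis E0 : E 0 = 1.
Hypothesis ED : forall a b, E (a + b) = E a * E b.

Let EN a : E a * E (- a) = 1.
Proof. by rewrite -ED subrr E0. Qed.

Let E_neq0 a : E a != 0.
Proof. by apply/eqP => Ea; have /eqP := EN a; rewrite Ea mul0r eq_sym oner_eq0. Qed.

Let ENV a : E (- a) = (E a)^-1.
Proof. by apply: (mulfI (E_neq0 a)); rewrite EN divff. Qed.

Variables t1 t2 t3 : int.
(** The antisymmetrisation of a character over the Weyl group of type A2. With
    [x_i = E t_i] and [p = (u + v, v, 0)] it is the determinant of the powers
    [x_i ^ p_j], simplified by [x_1 x_2 x_3 = 1]. *)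
Definition psi (u v : int) : C :=
  E (t1 * u - t3 * v) - E (t2 * u - t3 * v) - E (t1 * u - t2 * v)
  - E (t3 * u - t1 * v) + E (t2 * u - t1 * v) + E (t3 * u - t2 * v).

Lemma psi_u0 v : psi 0 v = 0.
Proof. by rewrite /psi !mulr0 !sub0r; ring. Qed.

Lemma psi_v0 u : psi u 0 = 0.
Proof. by rewrite /psi !mulr0 !subr0; ring. Qed.

(** Two rows of the determinant coincide. *)
Lemma psi_degenerate : E t1 = E t2 \/ E t2 = E t3 \/ E t1 = E t3 -> forall u v, psi u v = 0.
Proof.
have H (a b k : int) : E a = E b -> E (a * k) = E (b * k).
  move=> ab; have X (c : int) (n : nat) : E (c * n%:Z) = E c ^+ n.
    elim: n => [|n IH]; first by rewrite mulr0 E0.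
    by rewrite exprS -IH -ED; congr E; lia.
  by case: k => n; rewrite ?NegzE ?mulrN ?ENV !X ab.
by move=> [|[|]] => h u v; have Hu := H _ _ u h; have Hv := H _ _ v h;
  rewrite /psi !ED !ENV Hu Hv; ring.
Qed.

Hypothesis t_sum : t1 + t2 + t3 = 0.

(** Two columns of the determinant are proportional. *)
Lemma psi_wall (n u v : int) : E (t1 * n) = E (t2 * n) -> E (t2 * n) = E (t3 * n) ->
  u + v = n -> psi u v = 0.
Proof.
move=> e12 e23 uv; have -> : v = n - u by lia.
have H (a b c : int) : a + b + c = 0 -> E (a * u - b * (n - u)) = E (- (c * u)) * (E (b * n))^-1.
  move=> abc; have -> : c = - a - b by lia.
  by rewrite -ENV -ED; congr E; ring.
rewrite /psi (H t1 t3 t2); last lia.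
rewrite (H t2 t3 t1); last lia.
rewrite (H t1 t2 t3); last lia.
rewrite (H t3 t1 t2); last lia.
rewrite (H t2 t1 t3); last lia.
rewrite (H t3 t2 t1); last lia.
by rewrite e12 e23; ring.
Qed.

(** Each of the six steps multiplies a summand by one of the six factors, and each
    factor occurs once. *)
Lemma psi_shift u v :
  psi (u - 1) (v + 1) + psi (u - 1) v + psi (u + 1) (v - 1) +
  psi u (v - 1) + psi (u + 1) v + psi u (v + 1) =
  (E t1 + E (- t1) + E t2 + E (- t2) + E t3 + E (- t3)) * psi u v.
Proof.
have H (a b c : int) : a + b + c = 0 ->
   [/\ E (a * (u - 1) - b * (v + 1)) = E c * E (a * u - b * v),
       E (a * (u - 1) - b * v) = E (- a) * E (a * u - b * v) &
       E (a * (u + 1) - b * (v - 1)) = E (- c) * E (a * u - b * v)] /\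
   [/\ E (a * u - b * (v - 1)) = E b * E (a * u - b * v),
       E (a * (u + 1) - b * v) = E a * E (a * u - b * v) &
       E (a * u - b * (v + 1)) = E (- b) * E (a * u - b * v)].
  move=> abc; have -> : c = - a - b by lia.
  by split; split; rewrite -ED; congr E; ring.
rewrite /psi.
have [[-> -> ->] [-> -> ->]] := H t1 t3 t2 ltac:(lia).
have [[-> -> ->] [-> -> ->]] := H t2 t3 t1 ltac:(lia).
have [[-> -> ->] [-> -> ->]] := H t1 t2 t3 ltac:(lia).
have [[-> -> ->] [-> -> ->]] := H t3 t1 t2 ltac:(lia).
have [[-> -> ->] [-> -> ->]] := H t2 t1 t3 ltac:(lia).
have [[-> -> ->] [-> -> ->]] := H t3 t2 t1 ltac:(lia).
ring.
Qed.

(** A Vandermonde determinant. *)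
Lemma psi_11 : E t1 != E t2 -> E t2 != E t3 -> E t1 != E t3 -> psi 1 1 != 0.
Proof.
move=> h12 h23 h13.
have e123 : E t1 * E t2 * E t3 = 1 by rewrite -!ED t_sum.
have -> : psi 1 1 = (E t1 - E t2) * (E t2 - E t3) * (E t1 - E t3) *
    (E t1 * E t2 * E t3)^-1.
  rewrite /psi !mulr1 !ED !ENV; field.
  by rewrite !E_neq0.
by rewrite e123 invr1 mulr1 !mulf_neq0 // subr_eq0.
Qed.

End AntisymmetricSums.

Section FourierInversion.
Variables (C : numFieldType) (E : int -> C) (N : nat).
Hypothesis E0 : E 0 = 1.
Hypothesis ED : forall a b, E (a + b) = E a * E b.
Hypothesis N0 : (0 < N)%N.
Hypothesis E1 : forall k, E k = 1 <-> ((3 * N)%:Z %| k)%Z.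

Let geometric_sum (n : nat) k : E (n%:Z * k) = 1 -> E k != 1 ->
  \sum_(0 <= s < n) E (s%:Z * k) = 0.
Proof.
move=> h1 h2; apply/eqP; rewrite -(mulrI_eq0 _ (mulfI _ (x := E k - 1))) ?subr_eq0 //.
rewrite mulrBl mul1r mulr_sumr.
have -> : \sum_(0 <= i < n) E k * E (i%:Z * k) = \sum_(0 <= i < n) E (i.+1%:Z * k).
  by apply: eq_bigr => i _; rewrite -ED; congr E; lia.
rewrite -sumrB telescope_sumr // mul0r E0 h1 subrr //.
Qed.

Let double_sum (a b : int) :
  \sum_(0 <= s < 3 * N) \sum_(0 <= r < N) E (s%:Z * a + 3 * r%:Z * b) =
  if ((3 * N)%:Z %| a)%Z && (N%:Z %| b)%Z then (3 * N * N)%:R else 0.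
Proof.
transitivity ((\sum_(0 <= s < 3 * N) E (s%:Z * a)) * (\sum_(0 <= r < N) E (r%:Z * (3 * b)))).
  rewrite mulr_suml; apply: eq_bigr => s _; rewrite mulr_sumr; apply: eq_bigr => r _.
  by rewrite -ED; congr E; ring.
have [ha|ha] /= := boolP ((3 * N)%:Z %| a)%Z; last first.
  rewrite geometric_sum ?mul0r //; first by apply/E1; rewrite dvdz_mulr.
  by apply/eqP => /E1; rewrite (negbTE ha).
have [hb|hb] := boolP (N%:Z %| b)%Z; last first.
  rewrite [X in _ * X]geometric_sum ?mulr0 //.
    by apply/E1; rewrite mulrA (mulrC _ 3) dvdz_mulr // PoszM dvdzz.
  by apply/eqP => /E1; rewrite PoszM dvdz_mul2l //= (negbTE hb).
rewrite (eq_bigr (fun=> 1)) => [|s _]; last by apply/E1; rewrite dvdz_mull.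
rewrite [X in _ * X](eq_bigr (fun=> 1)) => [|s _]; last first.
  by apply/E1; rewrite dvdz_mull // PoszM dvdz_mul2l.
by rewrite !sumr_const_nat !subn0 -natrM.
Qed.

Let no_mult (n : nat) (x : int) : (n%:Z %| x)%Z -> - n%:Z < x -> x < 0 -> False.
Proof. by move=> /dvdzP[k ->] h1 h2; have [k0|k0] := leP 0 k; nia. Qed.

Let zero_mult (n : nat) (x : int) : (n%:Z %| x)%Z -> - n%:Z < x -> x < n%:Z -> x = 0.
Proof.
move=> /dvdzP[k ->] h1 h2; have [k0|k0] := leP k 0; last by nia.
have [k1|k1] := leP 0 k; last by nia.
by have -> : k = 0 by lia.
Qed.

Let not_both (a b : int) : - 2 * N%:Z < b -> b < N%:Z ->
  (b = 0 \/ b = - N%:Z -> - (3 * N)%:Z < a /\ a < 0) ->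
  ((3 * N)%:Z %| a)%Z && (N%:Z %| b)%Z = false.
Proof.
move=> b1 b2 h; apply/negP => /andP[d1 d2].
have {d2} b0 : b = 0 \/ b = - N%:Z.
  have [bN|bN] := ltP (- N%:Z) b; [left; exact: zero_mult d2 bN b2 | right].
  move: d2 => /dvdzP[k bk]; suff : b + N%:Z = 0 by clear -bN; lia.
  apply: (@zero_mult N); last 2 first.
  - by clear -b1; lia.
  - by clear -bN N0; lia.
  by apply/dvdzP; exists (k + 1); rewrite bk; ring.
by have [h1 h2] := h b0; apply: no_mult d1 h1 h2.
Qed.

(** Orthogonality of characters; only the identity permutation contributes,
    because the points [(u, v)] and [(u', v')] lie in one alcove of the affine
    Weyl group. *)
Lemma fourier_inversion (u v u' v' : int) : 0 < u -> 0 < v -> u + v < N%:Z ->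
  0 < u' -> 0 < v' -> u' + v' < N%:Z ->
  \sum_(0 <= s < 3 * N) \sum_(0 <= r < N)
    E (- (s%:Z * u') + (- 2 * s%:Z - 3 * r%:Z) * v') *
    psi E s%:Z (s%:Z + 3 * r%:Z) (- 2 * s%:Z - 3 * r%:Z) u v =
  ((u == u') && (v == v'))%:R * (3 * N * N)%:R.
Proof.
move=> u0 v0 uv u'0 v'0 uv'.
pose D a b := \sum_(0 <= s < 3 * N) \sum_(0 <= r < N) E (s%:Z * a + 3 * r%:Z * b).
transitivity (D (u - u' - 2 * v' + 2 * v) (v - v')
  - D (- u' - 2 * v' + u + 2 * v) (- v' + u + v)
  - D (- u' - 2 * v' + u - v) (- v' - v)
  - D (- u' - 2 * v' - 2 * u - v) (- v' - u)
  + D (- u' - 2 * v' + u - v) (- v' + u)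
  + D (- u' - 2 * v' - 2 * u - v) (- v' - u - v)).
  rewrite /D -!sumrB -!big_split; apply: eq_bigr => s _ /=.
  rewrite -!sumrB -!big_split; apply: eq_bigr => r _ /=.
  rewrite /psi; move: (s%:Z) (r%:Z) => {}s {}r.
  rewrite mulrDr mulrDr !mulrBr -!ED.
  by congr (_ - _ - _ - _ + _ + _); congr E; ring.
rewrite /D !double_sum.
rewrite (@not_both (- u' - 2 * v' + u + 2 * v) (- v' + u + v)); [|lia|lia|lia].
rewrite (@not_both (- u' - 2 * v' + u - v) (- v' - v)); [|lia|lia|lia].
rewrite (@not_both (- u' - 2 * v' - 2 * u - v) (- v' - u)); [|lia|lia|lia].
rewrite (@not_both (- u' - 2 * v' + u - v) (- v' + u)); [|lia|lia|lia].
rewrite (@not_both (- u' - 2 * v' - 2 * u - v) (- v' - u - v)); [|lia|lia|lia].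
rewrite !subr0 !addr0.
case: ifP => [/andP[/zero_mult h1 /zero_mult h2]|n1].
  have vv : v - v' = 0 by apply: h2; clear h1; lia.
  have uu : u - u' - 2 * v' + 2 * v = 0 by apply: h1; clear h2; lia.
  clear h1 h2; have -> : u = u' by lia.
  have -> : v = v' by lia.
  by rewrite !eqxx mul1r.
have [Eu|] := eqVneq u u'; last by rewrite mul0r.
have [Ev|] := eqVneq v v'; last by rewrite mul0r.
move: n1; rewrite Eu Ev (_ : u' - u' - 2 * v' + 2 * v' = 0); last by lia.
by rewrite subrr !dvdz0.
Qed.

End FourierInversion.

Section ComplexExponential.
Variables (R : realType) (N : nat).
Hypothesis N0 : (0 < N)%N.

Definition angle (k : int) : R := 2 * pi * k%:~R / (3 * N%:R).

(** [cis k] is exp(2 i pi k / 3N). *)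
Definition cis (k : int) : R[i] := Complex (cos (angle k)) (sin (angle k)).

Let n0 : 3 * N%:R != 0 :> R.
Proof. by rewrite mulf_neq0 // pnatr_eq0 -?lt0n. Qed.

Let angleD a b : angle (a + b) = angle a + angle b.
Proof. by rewrite /angle intrD; field; rewrite pnatr_eq0 -lt0n. Qed.

Lemma cisD a b : cis (a + b) = cis a * cis b.
Proof. by rewrite /cis angleD cosD sinD; congr Complex; ring. Qed.

Lemma cis0 : cis 0 = 1.
Proof. by rewrite /cis /angle mulr0 mul0r cos0 sin0. Qed.

Let cis_period : cis (3 * N)%:Z = 1.
Proof.
rewrite /cis (_ : angle _ = pi *+ 2) ?cos2pi ?sin2pi //.
rewrite /angle -pmulrn natrM -mulrA divff ?mulr1 //.
by rewrite mulrC mulr_natr.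
Qed.

Let cis_mult k : cis (k * (3 * N)%:Z) = 1.
Proof.
have cN a : cis a = 1 -> cis (- a) = 1.
  by move=> ha; have := cisD a (- a); rewrite subrr cis0 ha mul1r.
have cn (n : nat) : cis (n%:Z * (3 * N)%:Z) = 1.
  elim: n => [|n IH]; first by rewrite mul0r cis0.
  by rewrite intS mulrDl mul1r cisD cis_period IH mulr1.
by case: k => n; rewrite ?NegzE ?mulNr; [apply: cn | apply/cN/cn].
Qed.

(** Modulo [3N] the angle lies between 0 and 2 pi, and 1 - cos is twice the square of the
    sine of the half angle. *)
Lemma cis_eq1 k : cis k = 1 <-> ((3 * N)%:Z %| k)%Z.
Proof.
split=> [|/dvdzP[m ->]]; last exact: cis_mult.
have n3 : (3 * N)%:Z != 0 by lia.
rewrite {1}(divz_eq k (3 * N)%:Z) cisD cis_mult mul1r => E.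
have r0 : (0 <= k %% (3 * N)%:Z)%Z by rewrite modz_ge0.
have rN : (k %% (3 * N)%:Z)%Z < (3 * N)%:Z by rewrite ltz_pmod //; lia.
apply/dvdz_mod0P/eqP; rewrite eq_le r0 andbT leNgt; apply/negP => rp.
set r := (k %% _)%Z in E r0 rN rp.
pose th := angle r / 2.
have N3 : 0 < 3 * N%:R :> R by rewrite mulr_gt0 // ltr0n.
have thpos : 0 < th < pi.
  have ip : 0 < pi :> R := pi_gt0 R.
  have rr0 : 0 < r%:~R :> R by rewrite ltr0z.
  have rr1 : r%:~R < 3 * N%:R :> R.
    by move: rN; rewrite -(ltr_int R) -pmulrn natrM.
  have -> : th = pi * (r%:~R / (3 * N%:R)).
    by rewrite /th /angle; field; rewrite pnatr_eq0 -lt0n.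
  rewrite mulr_gt0 ?divr_gt0 //= -[ltRHS]mulr1 ltr_pM2l //.
  by rewrite ltr_pdivrMr // mul1r.
have s0 := sin_gt0_pi thpos.
have : cos (th *+ 2) = 1.
  by rewrite (_ : th *+ 2 = angle r); [case: E | rewrite /th; field].
rewrite cos_mulr2n cos2sin2 => h; have : sin th ^+ 2 = 0 by lra.
by move/eqP; rewrite sqrf_eq0 gt_eqF.
Qed.

Lemma cis_sum k : cis k + cis (- k) = (2 * cos (angle k))%:C%C.
Proof.
rewrite /cis (_ : angle (- k) = - angle k) ?cosN ?sinN; last first.
  by rewrite /angle mulrNz mulrN mulNr.
by rewrite /=; congr Complex; ring.
Qed.

End ComplexExponential.

(** * The fundamental alcove and the density of the eigenvalues *)

Section Alcove.
Variables (R : realType) (N : nat).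
Hypothesis N0 : (0 < N)%N.
Local Notation L k := (cos (angle R N k)).

Let L_period k m : L (k + m * (3 * N)%:Z) = L k.
Proof.
have : cis R N (k + m * (3 * N)%:Z) = cis R N k.
  by rewrite cisD // (_ : cis R N (m * _) = 1) ?mulr1 //; apply/cis_eq1; rewrite ?dvdz_mull.
by case.
Qed.

Let in_alcove (s : R) := exists m1 m2 m3 : int,
  [/\ m1 + m2 + m3 = 0, (0 < m1) && (0 < m2), - (N%:Z) < m3 & s = lambda_mN R m1 m2 m3 N].

Let sorted_in_alcove (a b c i j k : int) : 0 <= c -> 0 < i -> 0 < j -> a < (3 * N)%:Z ->
  a = b + 3 * i -> b = c + 3 * j -> a + b + c = k * (3 * N)%:Z ->
  in_alcove (3^-1 * (L a + L b + L c)).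
Proof.
move=> c0 i0 j0 aN ab bc sum.
have k12 : k = 1 \/ k = 2.
  have [k0|k0] := leP k 0; first by nia.
  by have [k3|k3] := leP 3 k; [nia | lia].
case: k12 => k12; rewrite {}k12 in sum.
  exists (N%:Z - i - j), j, (i - N%:Z); split; [lia | lia | lia | ].
  rewrite -(L_period a (-1)) /lambda_mN -!/(angle R N _).
  rewrite (_ : N%:Z - i - j - j = c); last lia.
  rewrite (_ : j - (i - N%:Z) = b); last lia.
  rewrite (_ : i - N%:Z - (N%:Z - i - j) = a + -1 * (3 * N)%:Z); last lia.
  by congr (_ * _); ring.
exists i, (N%:Z - i - j), (j - N%:Z); split; [lia | lia | lia | ].
rewrite -(L_period a (-1)) -(L_period b (-1)) /lambda_mN -!/(angle R N _).
rewrite (_ : i - (N%:Z - i - j) = a + -1 * (3 * N)%:Z); last lia.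
rewrite (_ : N%:Z - i - j - (j - N%:Z) = c); last lia.
rewrite (_ : j - N%:Z - i = b + -1 * (3 * N)%:Z); last lia.
by congr (_ * _); ring.
Qed.

(** Every regular weight is moved into the fundamental alcove by the affine Weyl
    group, which leaves the eigenvalue unchanged: reduce modulo [3N], sort, and
    subtract [3N] from the largest entries. *)
Lemma regular_in_alcove (s r : int) :
  let t1 := s in let t2 := s + 3 * r in let t3 := - 2 * s - 3 * r in
  cis R N t1 != cis R N t2 -> cis R N t2 != cis R N t3 -> cis R N t1 != cis R N t3 ->
  in_alcove (3^-1 * (L t1 + L t2 + L t3)).
Proof.
move=> t1 t2 t3 n12 n23 n13.
have red t : exists a m, [/\ t = a + m * (3 * N)%:Z, 0 <= a, a < (3 * N)%:Z,
    L t = L a & cis R N t = cis R N a].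
  exists (t %% (3 * N)%:Z)%Z, (t %/ (3 * N)%:Z)%Z.
  have E : t = (t %% (3 * N)%:Z)%Z + (t %/ (3 * N)%:Z)%Z * (3 * N)%:Z by rewrite addrC -divz_eq.
  split=> //; first by rewrite modz_ge0 //; lia.
  - by rewrite ltz_pmod //; lia.
  - by rewrite [in LHS]E L_period.
  - rewrite [in LHS]E cisD // (_ : cis R N (_ * _) = 1) ?mulr1 //.
    by apply/cis_eq1; rewrite ?dvdz_mull.
have [a [m1 [e1 a0 aN La Ea]]] := red t1.
have [b [m2 [e2 b0 bN Lb Eb]]] := red t2.
have [c [m3 [e3 c0 cN Lc Ec]]] := red t3.
rewrite La Lb Lc; rewrite Ea Eb Ec in n12 n23 n13.
have ab : a != b by apply: contraNneq n12 => ->.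
have bc : b != c by apply: contraNneq n23 => ->.
have ac : a != c by apply: contraNneq n13 => ->.
pose k := - m1 - m2 - m3.
have sum : a + b + c = k * (3 * N)%:Z by rewrite /k; rewrite /t1 /t2 /t3 in e1 e2 e3; lia.
pose x := r - m2 * N%:Z + m1 * N%:Z.
have bx : b = a + 3 * x by rewrite /x; rewrite /t1 /t2 /t3 in e1 e2 e3; lia.
pose y := - s - 2 * r - m3 * N%:Z + m2 * N%:Z.
have cy : c = b + 3 * y by rewrite /y; rewrite /t1 /t2 /t3 in e1 e2 e3; lia.
move: (k) sum (x) bx (y) cy => {}k sum {}x bx {}y cy.
clear -a0 aN b0 bN c0 cN ab bc ac sum bx cy sorted_in_alcove.
have xN : x != 0 by apply: contraNneq ab => x0; apply/eqP; lia.
have yN : y != 0 by apply: contraNneq bc => y0; apply/eqP; lia.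
have xyN : x + y != 0 by apply: contraNneq ac => xy0; apply/eqP; lia.
have [x0|x0] := ltP 0 x; have [y0|y0] := ltP 0 y.
- rewrite (_ : L a + L b + L c = L c + L b + L a); last by ring.
  by apply: (@sorted_in_alcove c b a y x k); lia.
- have [z0|z0] := ltP 0 (x + y).
    rewrite (_ : L a + L b + L c = L b + L c + L a); last by ring.
    by apply: (@sorted_in_alcove b c a (- y) (x + y) k); lia.
  rewrite (_ : L a + L b + L c = L b + L a + L c); last by ring.
  by apply: (@sorted_in_alcove b a c x (- (x + y)) k); lia.
- have [z0|z0] := ltP 0 (x + y).
    rewrite (_ : L a + L b + L c = L c + L a + L b); last by ring.
    by apply: (@sorted_in_alcove c a b (x + y) (- x) k); lia.
  rewrite (_ : L a + L b + L c = L a + L c + L b); last by ring.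
  by apply: (@sorted_in_alcove a c b (- (x + y)) y k); lia.
- by apply: (@sorted_in_alcove a b c (- x) (- y) k); lia.
Qed.

End Alcove.

Section Density.
Variables (R : realType).

Let cos_lipschitz (a b : R) : `|cos a - cos b| <= `|a - b|.
Proof.
wlog ab : a b / a < b => [hw|].
  have [ab|ba|->] := ltgtP a b; [exact: hw| |by rewrite !subrr].
  by rewrite distrC [leRHS]distrC hw.
have [c _ E] := @MVT R cos (fun x => - sin x) a b ab (fun x _ => is_derive_cos x)
  (continuous_subspaceT (@continuous_cos R)).
rewrite distrC [leRHS]distrC E normrM normrN ler_piMl //.
by rewrite ler_norml sin_geN1 sin_le1.
Qed.

(** For the cosine [x] of this angle, the triple angle formula says that
    [(x - 1) * (2 * x + 1) ^+ 2 = 0]. *)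
Let cos_2pi3 : cos (2 * pi / 3) = - 2^-1 :> R.
Proof.
set w : R := 2 * pi / 3.
have p0 := pi_gt0 R.
have s0 : 0 < sin w by apply: sin_gt0_pi; rewrite /w; apply/andP; split; lra.
have : cos (w *+ 2 + w) = 1.
  by rewrite -cos2pi; congr cos; rewrite /w mulr2n; field.
rewrite cosD cos_mulr2n sin_mulr2n.
have := cos2Dsin2 w; set x := cos w; set y := sin w in s0 *; move=> e1 e2.
have f : (x - 1) * (2 * x + 1) ^+ 2 = 0.
  have : y ^+ 2 = 1 - x ^+ 2 by lra.
  move=> y2; have e3 : (x ^+ 2 *+ 2 - 1) * x - 2 * x * y ^+ 2 = 1.
    by rewrite -[RHS]e2; ring.
  have -> : (x - 1) * (2 * x + 1) ^+ 2 = (x ^+ 2 *+ 2 - 1) * x - 2 * x * (1 - x ^+ 2) - 1 by ring.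
  by rewrite -y2 e3 subrr.
move/eqP: f; rewrite mulf_eq0 sqrf_eq0 => /orP[/eqP h|/eqP h]; last by lra.
have x1 : x = 1 by lra.
by exfalso; move: e1; rewrite x1; nra.
Qed.

(** The substitution [c = cos (2 * pi * y / 3)] makes the right-hand side
    [(2 * c ^+ 2 + 2 * c - 1) / 3], which increases from -1/2 to 1 for [c] between
    -1/2 and 1. *)
Let deltoid_edge (t : R) : - 2^-1 <= t <= 1 ->
  exists2 y, 0 <= y <= 1 &
    t = 3^-1 * (cos (2 * pi * y / 3) + cos (2 * pi * y / 3) + cos (2 * pi * y / 3 *+ 2)).
Proof.
move=> /andP[t0 t1].
pose c := (Num.sqrt (3 + 6 * t) - 1) / 2.
have r0 : 0 <= 3 + 6 * t by lra.
have sq : Num.sqrt (3 + 6 * t) ^+ 2 = 3 + 6 * t by rewrite sqr_sqrtr.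
have s0 := sqrtr_ge0 (3 + 6 * t).
have cle : c <= 1 by rewrite /c; nra.
have cge : - 2^-1 <= c by rewrite /c; lra.
have tE : t = 3^-1 * (2 * c ^+ 2 + 2 * c - 1).
  by rewrite /c; move: sq; set s := Num.sqrt _ => sq; nra.
have cI : -1 <= c <= 1 by apply/andP; split; lra.
pose x := acos c.
have cx : cos x = c by apply: acosK; rewrite in_itv.
have p0 := pi_gt0 R.
have x0 : 0 <= x by apply: acos_ge0.
have xpi : x <= pi by apply: acos_lepi.
have xle : x <= 2 * pi / 3.
  rewrite leNgt; apply/negP => lt; have : cos x < cos (2 * pi / 3).
    by rewrite ltr_cos // in_itv /=; apply/andP; split; lra.
  by rewrite cos_2pi3 cx; lra.
exists (3 * x / (2 * pi)).
  by apply/andP; split; [rewrite divr_ge0 //; lra | rewrite ler_pdivrMr; lra].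
have F (p z : R) : 0 < p -> 2 * p * (3 * z / (2 * p)) / 3 = z.
  by move=> p_gt0; field; rewrite gt_eqF.
by rewrite F // cos_mulr2n cx tE; ring.
Qed.

Let nat_approx (y : R) (n : nat) : 0 <= y <= 1 ->
  exists k : nat, [/\ k%:R <= y * n%:R, y * n%:R < k%:R + 1 & (k <= n)%N].
Proof.
move=> /andP[y0 y1]; have y'0 : 0 <= y * n%:R by rewrite mulr_ge0 ?ler0n.
exists (Num.truncn (y * n%:R)).
have /andP[k1 k2] := truncn_itv y'0; split=> //; first by rewrite natr1.
by rewrite -(ler_nat R); apply: le_trans k1 _; rewrite ler_piMl ?ler0n.
Qed.

Let lambda_approx (y : R) (k n : nat) : 0 <= y <= 1 ->
  k%:R <= y * n.+1%:R -> y * n.+1%:R < k%:R + 1 ->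
  `|lambda_mN R (k%:Z + 1) 1 (- k%:Z - 2) n.+4 -
    3^-1 * (cos (2 * pi * y / 3) + cos (2 * pi * y / 3) + cos (2 * pi * y / 3 *+ 2))|
  * n.+4%:R <= 32.
Proof.
move=> /andP[y0 y1] k1 k2; set x := 2 * pi * y / 3.
have : n.+4%:R = n.+1%:R + 3 :> R by rewrite -natrD; congr (_%:R); lia.
have : 1 <= n.+1%:R :> R by rewrite ler1n.
move: (n.+1%:R) k1 k2 => n1 k1 k2 n1_ge1 NR.
rewrite /lambda_mN.
rewrite addrK (_ : 1 - (- k%:Z - 2) = (k + 3)%:Z); last by clear; lia.
rewrite (_ : - k%:Z - 2 - (k%:Z + 1) = - (2 * k + 3)%:Z); last by clear; lia.
rewrite mulrNz -!pmulrn (natrD _ k 3) (natrD _ (2 * k) 3) natrM.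
have Npos : 0 < n.+4%:R :> R by rewrite NR; lra.
move: (n.+4%:R) NR Npos (k%:R) k1 k2 => N NR Npos {}k k1 k2.
have p4 : pi < 4 :> R by have := pihalf_lt2 R; lra.
have p0 := pi_gt0 R.
have xw : x = (2 * pi / (3 * N)) * (y * N).
  have F (p z M : R) : 0 < M -> 2 * p * z / 3 = 2 * p / (3 * M) * (z * M).
    by move=> M_gt0; field; rewrite gt_eqF.
  exact: F.
have w0 : 0 < 2 * pi / (3 * N) by rewrite divr_gt0 //; lra.
have wN : 12 * (2 * pi / (3 * N)) * N < 32.
  have F (p M : R) : 0 < M -> 12 * (2 * p / (3 * M)) * M = 8 * p.
    by move=> M_gt0; field; rewrite gt_eqF.
  by rewrite F //; lra.
have E z : 2 * pi * z / (3 * N) = (2 * pi / (3 * N)) * z by rewrite mulrAC.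
rewrite !{}E; move: (2 * pi / (3 * N)) w0 wN xw => w w0 wN xw.
have yN1 : k <= y * N by rewrite NR; nra.
have yN2 : y * N <= k + 4 by rewrite NR; nra.
have near (a b : R) : `|b - a| <= 12 -> `|cos (w * a) - cos (w * b)| <= 12 * w.
  move=> h; apply: le_trans (cos_lipschitz _ _) _.
  by rewrite -mulrBr normrM gtr0_norm // mulrC ler_pM2r // distrC.
have a1 := near k (y * N); have a2 := near (k + 3) (y * N).
have a3 := near (- (2 * k + 3)) (- (2 * (y * N))).
have e3 : cos (w * - (2 * (y * N))) = cos (x *+ 2).
  by rewrite mulrN cosN xw mulr2n; congr cos; ring.
rewrite -xw in a1 a2; rewrite e3 in a3.
have {}a1 : `|cos (w * k) - cos x| <= 12 * w by apply: a1; rewrite ler_norml; lra.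
have {}a2 : `|cos (w * (k + 3)) - cos x| <= 12 * w by apply: a2; rewrite ler_norml; lra.
have {}a3 : `|cos (w * - (2 * k + 3)) - cos (x *+ 2)| <= 12 * w.
  by apply: a3; rewrite ler_norml; lra.
apply: le_trans (ltW wN); rewrite ler_pM2r //.
move: a1 a2 a3; rewrite !ler_norml.
by move=> /andP[? ?] /andP[? ?] /andP[? ?]; apply/andP; split; lra.
Qed.

(** The eigenvalues with [m2 = 1] already accumulate at every point of the
    interval: they follow the edge of the alcove where the cosine sum is
    2 cos x + cos 2x with x between 0 and 2 pi / 3. *)
Lemma lambda_set_dense (t eps : R) : - 2^-1 <= t <= 1 -> 0 < eps ->
  exists2 z, lambda_set R z & nsq (z - t%:C%C) < eps.
Proof.
move=> /deltoid_edge[y yI tE] e0.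
have [n nE] : exists n : nat, 1024 / eps < n.+1%:R.
  exists (Num.truncn (1024 / eps)).
  by have /andP[] := @truncn_itv R (1024 / eps) (divr_ge0 (ler0n _ _) (ltW e0)).
have [k [k1 k2 kn]] := nat_approx n.+1 yI.
have := lambda_approx yI k1 k2; rewrite -tE.
set lam := lambda_mN R _ _ _ _ => zN.
exists lam%:C%C.
  by exists (k%:Z + 1), 1, (- k%:Z - 2), n.+4; split=> //; move: kn; clear; lia.
have -> : nsq (lam%:C%C - t%:C%C) = `|lam - t| ^+ 2.
  by rewrite /nsq /= subrr expr0n addr0 real_normK ?num_real.
have n4 : n.+1%:R <= n.+4%:R :> R by rewrite ler_nat; lia.
have n1 : 1 <= n.+1%:R :> R by rewrite ler1n.
have z0 := normr_ge0 (lam - t); move: (`|lam - t|) (n.+4%:R) (n.+1%:R) z0 zN n4 n1 nE.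
move=> z N n1 z0 zN n4 n1_ge1 nE; clear -e0 z0 zN n4 n1_ge1 nE.
have Npos : 0 < N by lra.
have zN2 : (z * N) ^+ 2 <= 32 ^+ 2 by rewrite ler_pXn2r ?nnegrE // mulr_ge0 // ltW.
have e1024 : 1024 < eps * N by move: nE; rewrite ltr_pdivrMr // mulrC; nra.
have z1 : z ^+ 2 * N <= (z * N) ^+ 2.
  by rewrite exprMn ler_wpM2l ?sqr_ge0 // expr2 ler_peMl //; lra.
rewrite -(ltr_pM2r Npos); apply: le_lt_trans z1 _; apply: le_lt_trans zN2 _.
by rewrite (_ : 32 ^+ 2 = 1024) // -natrX.
Qed.

End Density.

(** * Haar functions on the levels of a tree *)

Section Haar.
Variables (R : realType).
Local Notation C := R[i].

Variables (T : choiceType) (par : T -> T) (h : T -> int) (ch : T -> seq T) (q : nat).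
Hypothesis h_par : forall x, h (par x) = h x - 1.
Hypothesis ch_uniq : forall x, uniq (ch x).
Hypothesis ch_size : forall x, size (ch x) = q.
Hypothesis mem_ch : forall x y, (y \in ch x) = (par y == x).

Fixpoint desc n a : seq T := if n is n'.+1 then flatten [seq desc n' c | c <- ch a] else [:: a].

Lemma mem_desc n a y : (y \in desc n a) = (iter n par y == a).
Proof.
elim: n a => [|n IH] a /=; first by rewrite inE.
apply/flatten_mapP/eqP => [[c]|E].
  by rewrite mem_ch IH => /eqP <- /eqP <-.
by exists (iter n par y); rewrite ?mem_ch ?IH // E.
Qed.

Lemma desc_uniq n a : uniq (desc n a).
Proof.
elim: n a => [|n IH] a //=.
have : uniq (ch a) by [].
elim: (ch a) => [|c s IHs] //= /andP[cs us].
rewrite cat_uniq IH IHs // andbT; apply/hasPn => y /flatten_mapP[d ds].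
rewrite !mem_desc => /eqP Ed; apply/eqP => Ec; by move: cs; rewrite -Ec Ed ds.
Qed.

Lemma desc_size n a : size (desc n a) = (q ^ n)%N.
Proof.
elim: n a => [|n IH] a //=.
rewrite size_flatten /shape -map_comp (eq_map (g := fun=> (q ^ n)%N)) => [|c]; last exact: IH.
by rewrite sumnE big_map big_const_seq count_predT ch_size iter_addn_0 expnS mulnC.
Qed.

Lemma iter_height n y : h (iter n par y) = h y - n%:Z.
Proof. by elim: n => [|n IH] /=; [rewrite subr0 | rewrite h_par IH; lia]. Qed.

Definition desc_sum n a (g : T -> C) := \sum_(y <- desc n a) g y.

Lemma desc_sumS n a g : desc_sum n.+1 a g = \sum_(c <- ch a) desc_sum n c g.
Proof. by rewrite /desc_sum /= big_flatten big_map. Qed.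

(** The indicator function of the branch below [c] minus that of the branch below its
    sibling [c']. *)
Definition haar (c c' y : T) : C :=
  if h y < h c then 0
  else (iter `|h y - h c|%N par y == c)%:R - (iter `|h y - h c|%N par y == c')%:R.

Definition haar_supp n c c' := undup (desc n c ++ desc n c').

Section Siblings.
Variables (c c' : T).
Hypothesis cc' : par c = par c'.

Lemma sibling_height : h c' = h c.
Proof. by have := h_par c; have := h_par c'; rewrite cc'; lia. Qed.

Lemma haar_above y : h y < h c -> haar c c' y = 0.
Proof. by rewrite /haar => ->. Qed.

Lemma haar_par y : h c < h y -> haar c c' (par y) = haar c c' y.
Proof.
move=> hy; rewrite /haar h_par !ifF; [|lia|lia].
have -> : absz (h y - h c) = (absz (h y - 1 - h c)%R).+1 by lia.
by rewrite iterSr.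
Qed.

Lemma haar_desc n y : h y = h c + n%:Z ->
  haar c c' y = (y \in desc n c)%:R - (y \in desc n c')%:R.
Proof.
move=> hy; rewrite /haar ifF; last by rewrite hy; lia.
by rewrite !mem_desc (_ : `|h y - h c|%N = n) // hy; lia.
Qed.

Lemma haar_sum_children y : h c <= h y ->
  \sum_(z <- ch y) haar c c' z = q%:R * haar c c' y.
Proof.
move=> hy; rewrite big_seq (eq_bigr (fun=> haar c c' y)) => [|z]; last first.
  rewrite mem_ch => /eqP zy; rewrite -zy haar_par //.
  by have := h_par z; rewrite zy; lia.
by rewrite -big_seq big_const_seq count_predT ch_size iter_addr_0 mulr_natl.
Qed.

Lemma haar_sum_children_above y : h y < h c -> \sum_(z <- ch y) haar c c' z = 0.
Proof.
move=> hy; have hz z : z \in ch y -> h z = h y + 1.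
  by rewrite mem_ch => /eqP <-; rewrite h_par subrK.
have [E|N] := eqVneq (h y + 1) (h c); last first.
  by rewrite big_seq big1 // => z /hz zy; apply: haar_above; rewrite zy; lia.
rewrite big_seq (eq_bigr (fun z => (z == c)%:R - (z == c')%:R)); last first.
  move=> z /hz zy; rewrite (haar_desc (n := 0)) ?inE //.
  by rewrite zy E addr0.
rewrite -big_seq sumrB.
have cnt d : \sum_(z <- ch y) (z == d)%:R = (d \in ch y)%:R :> C.
  have [dy|dy] := boolP (d \in ch y).
    rewrite (bigD1_seq d) //= eqxx big1 ?addr0 // => z /negbTE -> //.
  rewrite big_seq big1 // => z zy; case: eqP => // zd.
  by rewrite -zd zy in dy.
by rewrite !cnt !mem_ch cc' subrr.
Qed.

Lemma sum_haar n g :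
  \sum_(y <- haar_supp n c c') haar c c' y * g y = desc_sum n c g - desc_sum n c' g.
Proof.
have hS y : y \in haar_supp n c c' -> h y = h c + n%:Z.
  rewrite mem_undup mem_cat !mem_desc => /orP[]/eqP E; have := iter_height n y; rewrite E;
    rewrite ?sibling_height; lia.
rewrite big_seq (eq_bigr (fun y => (y \in desc n c)%:R * g y - (y \in desc n c')%:R * g y)).
  rewrite -big_seq sumrB.
  have sub d : {subset desc n d <= haar_supp n c c'} ->
      \sum_(y <- haar_supp n c c') (y \in desc n d)%:R * g y = desc_sum n d g.
    move=> sd; transitivity (\sum_(y <- desc n d) (y \in desc n d)%:R * g y).
      have := @sum_support R _ (desc n d) (haar_supp n c c') (fun y => (y \in desc n d)%:R * g y).
      move=> <- //; first exact: desc_uniq.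
      - exact: undup_uniq.
      - by move=> v /negbTE ->; rewrite mul0r.
      - move=> v vS; case: (boolP (v \in desc n d)) => [/sd|_]; last by rewrite mul0r.
        by rewrite (negbTE vS).
    by rewrite /desc_sum big_seq [RHS]big_seq; apply: eq_bigr => y ->; rewrite mul1r.
  by rewrite !sub // => y yd; rewrite mem_undup mem_cat yd ?orbT.
by move=> y /hS hy; rewrite (haar_desc hy) mulrBl.
Qed.

End Siblings.

Hypothesis q2 : (2 <= q)%N.

(** Averages over larger and larger families of cousins tend to 0. *)
Definition small (g : T -> C) :=
  forall y, ccvg (fun n => q%:R ^- n * desc_sum n (iter n par y) g) 0.

(** By Cauchy-Schwarz the average over [q ^ n] points is at most [q ^ (-n/2)] times the
    norm. *)
Lemma small_bnd g K : bnd g K -> small g.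
Proof.
move=> hg y; have q0 : 0 < q%:R :> R by rewrite ltr0n; lia.
apply: (@ccvg0_geometric _ _ K q%:R^-1); first by rewrite invr_ge0 ltW.
  by rewrite invf_lt1 // ltr1n.
move=> n; rewrite nsqM.
have -> : q%:R ^- n = (real_complex R (q%:R ^- n)).
  by rewrite fmorphV rmorphXn rmorph_nat.
have -> : nsq (real_complex R (q%:R ^- n)) = (q%:R ^- n) ^+ 2.
  by rewrite /nsq /= expr0n addr0.
have := nsq_sum (desc n (iter n par y)) g; rewrite desc_size => hL.
have hK := hg _ (desc_uniq n (iter n par y)).
have qn : 0 < q%:R ^- n :> R by rewrite invr_gt0 exprn_gt0.
have := ler_wpM2l (sqr_ge0 (q%:R ^- n)) hL; move=> /le_trans; apply.
rewrite natrX mulrA [X in X * _ <= _](_ : _ = q%:R ^- n); last first.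
  by rewrite expr2 -mulrA mulVf ?mulr1 // expf_neq0 // gt_eqF.
by rewrite exprVn mulrC ler_wpM2r // ltW.
Qed.

Lemma small_sum (I : Type) (s : seq I) (k : I -> C) (g : I -> T -> C) :
  (forall i, small (g i)) -> small (fun y => \sum_(i <- s) k i * g i y).
Proof.
move=> hg y.
have := ccvg_sum s (fun i => ccvgZ (k i) (hg i y)).
rewrite big1 => [|i _]; last by rewrite mulr0.
congr (ccvg _ 0); apply/funext => n.
rewrite /desc_sum exchange_big mulr_sumr; apply: eq_bigr => i _.
by rewrite -mulr_sumr mulrCA.
Qed.

(** A function without Haar coefficients equals each of its averages over
    cousins. *)
Lemma haar_complete g : small g ->
  (forall n c c', par c = par c' -> \sum_(y <- haar_supp n c c') haar c c' y * g y = 0) ->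
  forall y, g y = 0.
Proof.
move=> sg hg y.
have qN : q%:R != 0 :> C by rewrite pnatr_eq0; lia.
have avg n : desc_sum n (iter n par y) g = q%:R ^+ n * g y.
  elim: n => [|n IH]; first by rewrite /desc_sum /= big_seq1 mul1r.
  (* siblings have equal sums, so the sum below their parent is q times as large *)
  rewrite [iter _ _ _]/= desc_sumS big_seq (eq_bigr (fun=> desc_sum n (iter n par y) g)); last first.
    move=> c; rewrite mem_ch => /eqP cy; apply/esym/eqP; rewrite -subr_eq0.
    by rewrite -sum_haar // hg.
  rewrite -big_seq big_const_seq count_predT ch_size iter_addr_0 IH exprS.
  by rewrite -mulrA mulr_natl.
apply: (ccvg_unique _ (sg y)); rewrite (_ : (fun n => _) = fun=> g y).
  exact: ccvg_cst.
by apply/funext => n; rewrite avg mulrA mulVf ?mul1r // expf_neq0.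
Qed.

(** Completeness is applied to one coordinate at a time; finite sums of slices stay
    small. *)
Lemma haar_complete3 (G : T -> T -> T -> C) K :
  (forall b c, bnd (fun a => G a b c) K) -> (forall a c, bnd (fun b => G a b c) K) ->
  (forall a b, bnd (fun c => G a b c) K) ->
  (forall n1 c1 c1' n2 c2 c2' n3 c3 c3', par c1 = par c1' -> par c2 = par c2' ->
     par c3 = par c3' ->
     \sum_(a <- haar_supp n1 c1 c1') \sum_(b <- haar_supp n2 c2 c2')
       \sum_(c <- haar_supp n3 c3 c3') haar c1 c1' a * haar c2 c2' b * haar c3 c3' c * G a b c = 0) ->
  forall a b c, G a b c = 0.
Proof.
move=> Ka Kb Kc hG a b c.
apply: (haar_complete (small_bnd (Ka b c))) => n1 c1 c1' e1.
move: b; apply: haar_complete.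
  by apply: small_sum => i; apply: small_bnd (Kb _ _).
move=> n2 c2 c2' e2.
pose g3 y := \sum_(p <- [seq (a, b) | a <- haar_supp n1 c1 c1', b <- haar_supp n2 c2 c2'])
  (haar c1 c1' p.1 * haar c2 c2' p.2) * G p.1 p.2 y.
have g3E y : g3 y = \sum_(b <- haar_supp n2 c2 c2') haar c2 c2' b *
    \sum_(a <- haar_supp n1 c1 c1') haar c1 c1' a * G a b y.
  rewrite /g3 big_allpairs_dep /= exchange_big /=; apply: eq_bigr => b _.
  by rewrite mulr_sumr; apply: eq_bigr => i _; ring.
rewrite -g3E; move: c; apply: haar_complete; first by apply: small_sum => p; apply: small_bnd (Kc _ _).
move=> n3 c3 c3' e3; clear a; rewrite -[RHS](hG n1 c1 c1' n2 c2 c2' n3 c3 c3') //.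
transitivity (\sum_(c <- haar_supp n3 c3 c3') \sum_(a <- haar_supp n1 c1 c1')
   \sum_(b <- haar_supp n2 c2 c2') haar c1 c1' a * haar c2 c2' b * haar c3 c3' c * G a b c).
  apply: eq_bigr => c _; rewrite /g3 big_allpairs_dep /= mulr_sumr; apply: eq_bigr => a _.
  by rewrite mulr_sumr; apply: eq_bigr => b _; ring.
by rewrite exchange_big /=; apply: eq_bigr => a _; rewrite exchange_big.
Qed.

End Haar.

(** * Functions on tetrahedra *)

Section TriangleEigenfunctions.
Variables (R : realType) (T : choiceType) (par : T -> T) (h : T -> int).
Variables (ch : T -> seq T) (q : nat).
Hypothesis h_par : forall x, h (par x) = h x - 1.
Hypothesis ch_uniq : forall x, uniq (ch x).
Hypothesis ch_size : forall x, size (ch x) = q.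
Hypothesis mem_ch : forall x y, (y \in ch x) = (par y == x).
Local Notation C := R[i].
Local Notation X := {ffun 'I_3 -> T}.
Local Notation hr := (haar R par h).

Variables (c1 c1' c2 c2' c3 c3' : T).
Hypothesis sib1 : par c1 = par c1'.
Hypothesis sib2 : par c2 = par c2'.
Hypothesis sib3 : par c3 = par c3'.

(** A tensor product of Haar functions; it vanishes outside the tetrahedron spanned by
    the parents of [c1], [c2], [c3]. *)
Definition haar3 (x : X) : C := hr c1 c1' (x 0) * hr c2 c2' (x 1) * hr c3 c3' (x 2).

Variable phi : int -> int -> C.

(** The two arguments of [phi] are the depths below the parents of [c1] and [c2]; the
    third depth is determined by them. *)
Definition tetra (x : X) : C :=
  haar3 x * phi (h (x 0) - h c1 + 1) (h (x 1) - h c2 + 1).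

Let Fm a b c := hr c1 c1' a * hr c2 c2' b * hr c3 c3' c *
  phi (h a - h c1 + 1) (h b - h c2 + 1).

Let tetra_triple a b c : tetra (triple a b c) = Fm a b c.
Proof. by rewrite /tetra /haar3 !ffunE. Qed.

(** On a tetrahedron the walk reduces to the simple random walk on a triangle of
    the triangular lattice, killed at the boundary: summing a Haar function over the
    children of a vertex multiplies its value by [q], and gives zero at the parent of
    [c] and [c']. *)
Lemma tetra_moves x : level h x = 0 ->
  (forall v, phi 0 v = 0) -> (forall u, phi u 0 = 0) ->
  (forall u v, u + v = 3 - (h c1 + h c2 + h c3) -> phi u v = 0) ->
  let u := h (x 0) - h c1 + 1 in let v := h (x 1) - h c2 + 1 in
  \sum_(y <- moves par ch x) tetra y = q%:R * haar3 x *
    (phi (u - 1) (v + 1) + phi (u - 1) v + phi (u + 1) (v - 1) + phi u (v - 1) +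
     phi (u + 1) v + phi u (v + 1)).
Proof.
move=> lx p1 p2 p3 u v.
rewrite [in LHS](tripleE x) (sum_moves_triple par ch) /=.
have lx' : h (x 0) + h (x 1) + h (x 2) = 0.
  by rewrite -(level_triple h) -tripleE.
rewrite /haar3; move: (x 0) (x 1) (x 2) lx' @u @v => a b c abc u v.
rewrite -/u -/v.
pose w := 3 - (h c1 + h c2 + h c3) - u - v.
have wE : w = h c - h c3 + 1 by rewrite /w /u /v; lia.
under eq_bigr do rewrite tetra_triple.
under [X in _ + X + _ + _ + _ + _]eq_bigr do rewrite tetra_triple.
under [X in _ + _ + X + _ + _ + _]eq_bigr do rewrite tetra_triple.
under [X in _ + _ + _ + X + _ + _]eq_bigr do rewrite tetra_triple.
under [X in _ + _ + _ + _ + X + _]eq_bigr do rewrite tetra_triple.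
under [X in _ + _ + _ + _ + _ + X]eq_bigr do rewrite tetra_triple.
have hch z y : z \in ch y -> h z = h y + 1.
  by rewrite mem_ch => /eqP <-; rewrite h_par subrK.
have S1 b' c0 : \sum_(a' <- ch a) Fm a' b' c0 =
    (\sum_(a' <- ch a) hr c1 c1' a') * (hr c2 c2' b' * hr c3 c3' c0 * phi (u + 1) (h b' - h c2 + 1)).
  rewrite mulr_suml big_seq [RHS]big_seq; apply: eq_bigr => a' /hch ha'.
  by rewrite /Fm ha' (_ : h a + 1 - h c1 + 1 = u + 1); [ring | rewrite /u; ring].
have S2 a' c0 : \sum_(b' <- ch b) Fm a' b' c0 =
    (\sum_(b' <- ch b) hr c2 c2' b') * (hr c1 c1' a' * hr c3 c3' c0 * phi (h a' - h c1 + 1) (v + 1)).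
  rewrite mulr_suml big_seq [RHS]big_seq; apply: eq_bigr => b' /hch hb'.
  by rewrite /Fm hb' (_ : h b + 1 - h c2 + 1 = v + 1); [ring | rewrite /v; ring].
have S3 a' b' : \sum_(c' <- ch c) Fm a' b' c' =
    (\sum_(c' <- ch c) hr c3 c3' c') * (hr c1 c1' a' * hr c2 c2' b' *
      phi (h a' - h c1 + 1) (h b' - h c2 + 1)).
  by rewrite mulr_suml; apply: eq_bigr => c' _; rewrite /Fm; ring.
rewrite !S1 !S2 !S3 !h_par -/u -/v.
rewrite (_ : h a - 1 - h c1 + 1 = u - 1); last by rewrite /u; ring.
rewrite (_ : h b - 1 - h c2 + 1 = v - 1); last by rewrite /v; ring.
have zero k k' y : par k = par k' -> h y < h k ->
    [/\ hr k k' y = 0, hr k k' (par y) = 0 & \sum_(z <- ch y) hr k k' z = 0].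
  move=> kk' yk; split; [exact: haar_above | | exact: haar_sum_children_above].
  by apply: haar_above; rewrite h_par; lia.
have [a0|a0] := ltP (h a) (h c1).
  by have [-> -> ->] := zero _ _ _ sib1 a0; rewrite !(mul0r, mulr0, addr0).
have [b0|b0] := ltP (h b) (h c2).
  by have [-> -> ->] := zero _ _ _ sib2 b0; rewrite !(mul0r, mulr0, addr0).
have [c0|c0] := ltP (h c) (h c3).
  by have [-> -> ->] := zero _ _ _ sib3 c0; rewrite !(mul0r, mulr0, addr0).
rewrite !(haar_sum_children R h_par ch_size mem_ch) //.
have P1 z : hr c1 c1' (par a) * phi (u - 1) z = hr c1 c1' a * phi (u - 1) z.
  have [E|N] := eqVneq (h a) (h c1).
    by rewrite (_ : u - 1 = 0) ?p1 ?mulr0 // /u E; ring.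
  by rewrite haar_par // lt_neqAle eq_sym N.
have P2 z : hr c2 c2' (par b) * phi z (v - 1) = hr c2 c2' b * phi z (v - 1).
  have [E|N] := eqVneq (h b) (h c2).
    by rewrite (_ : v - 1 = 0) ?p2 ?mulr0 // /v E; ring.
  by rewrite haar_par // lt_neqAle eq_sym N.
have P3 y z : y + z = u + v + 1 -> hr c3 c3' (par c) * phi y z = hr c3 c3' c * phi y z.
  move=> yz; have [E|N] := eqVneq (h c) (h c3).
    by rewrite p3 ?mulr0 // yz; move: wE; rewrite /w E; lia.
  by rewrite haar_par // lt_neqAle eq_sym N.
have Q1 := P1 (v + 1); have Q2 := P1 v; have Q3 := P2 (u + 1); have Q4 := P2 u.
have Q5 := P3 (u + 1) v ltac:(lia); have Q6 := P3 u (v + 1) ltac:(lia).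
transitivity (q%:R * (hr c2 c2' b * hr c3 c3' c * (hr c1 c1' (par a) * phi (u - 1) (v + 1)) +
   hr c2 c2' b * hr c3 c3' c * (hr c1 c1' (par a) * phi (u - 1) v) +
   hr c1 c1' a * hr c3 c3' c * (hr c2 c2' (par b) * phi (u + 1) (v - 1)) +
   hr c1 c1' a * hr c3 c3' c * (hr c2 c2' (par b) * phi u (v - 1)) +
   hr c1 c1' a * hr c2 c2' b * (hr c3 c3' (par c) * phi (u + 1) v) +
   hr c1 c1' a * hr c2 c2' b * (hr c3 c3' (par c) * phi u (v + 1)))); first by ring.
by rewrite Q1 Q2 Q3 Q4 Q5 Q6; ring.
Qed.

Lemma haar_in_supp c c' y : par c = par c' -> hr c c' y != 0 ->
  h c <= h y /\ y \in haar_supp ch `|h y - h c|%N c c'.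
Proof.
move=> cc' hy; have cy : h c <= h y by rewrite leNgt; apply/negP => /(haar_above R par c') E; rewrite E eqxx in hy.
split=> //; move: hy; rewrite mem_undup mem_cat /haar ifF; last by lia.
rewrite !(mem_desc mem_ch).
by case: (iter _ par y == c) => //; case: (iter _ par y == c') => //; rewrite subrr eqxx.
Qed.

Lemma haar3_finite_support :
  exists s : seq X, forall x, level h x = 0 -> haar3 x != 0 -> x \in s.
Proof.
pose N : nat := (absz (h c1 + h c2 + h c3)%R).+1.
pose D (c c' : T) := flatten [seq haar_supp ch n c c' | n <- iota 0 N].
exists [seq triple p.1 p.2 c | p <- [seq (a, b) | a <- D c1 c1', b <- D c2 c2'], c <- D c3 c3'].
move=> x; rewrite (tripleE x) level_triple /haar3 !ffunE /=.
move: (x 0) (x 1) (x 2) => a b c lx; rewrite !mulf_eq0 !negb_or => /andP[/andP[n1 n2] n3].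
have [h1 s1] := haar_in_supp sib1 n1.
have [h2 s2] := haar_in_supp sib2 n2.
have [h3 s3] := haar_in_supp sib3 n3.
apply/allpairsP; exists ((a, b), c); split=> //=.
  apply/allpairsP; exists (a, b); split=> //=.
    apply/flatten_mapP; exists `|h a - h c1|%N => //.
    by rewrite mem_iota /N; clear -h1 h2 h3 lx; lia.
  apply/flatten_mapP; exists `|h b - h c2|%N => //.
  by rewrite mem_iota /N; clear -h1 h2 h3 lx; lia.
apply/flatten_mapP; exists `|h c - h c3|%N => //.
by rewrite mem_iota /N; clear -h1 h2 h3 lx; lia.
Qed.

End TriangleEigenfunctions.

(** * The point spectrum *)

Section PointSpectrum.
Variables (R : realType) (T : choiceType) (e : rel T) (q : nat).
Hypothesis hT : homogeneous_tree e q.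
Hypothesis q2 : (2 <= q)%N.
Variables (omega : set (nat -> T)) (o : T).
Hypothesis homega : is_end e omega.

Local Notation C := R[i].
Local Notation X := {ffun 'I_3 -> T}.
Local Notation par := (parent omega).
Local Notation h := (busemann e omega o).
Local Notation DL := (DL e omega o).
Local Notation ch := (children hT o homega).
Local Notation P := (@srw T e omega o R q).

Let h_par := busemann_parent hT homega o.
Let ch_uniq := children_uniq hT o homega.
Let ch_size := children_size hT o homega.
Let mem_ch := mem_children hT o homega.

Let q0 : (0 < q)%N. Proof. exact: ltnW. Qed.

(** Extension by zero to all triples of vertices. *)
Definition extend (f : DL -> C) (x : X) : C :=
  if (insub x : option DL) is Some v then f v else 0.

Lemma extend_val f v : extend f (val v) = f v.
Proof. by rewrite /extend valK. Qed.

Lemma extend_out f x : level h x != 0 -> extend f x = 0.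
Proof. by move=> lx; rewrite /extend insubN. Qed.

Lemma sum_pmap (M : nmodType) (F : X -> M) (s : seq X) : (forall x, level h x != 0 -> F x = 0) ->
  \sum_(x <- s) F x = \sum_(v <- (pmap insub s : seq DL)) F (val v).
Proof.
move=> F0; elim: s => [|x s IH]; first by rewrite !big_nil.
rewrite big_cons IH /=; case: insubP => [v _ <-|lx] /=; first by rewrite big_cons.
by rewrite F0 ?add0r.
Qed.

Lemma bnd_extend f K : bnd f K -> bnd (extend f) K.
Proof.
move=> hf s us; rewrite (sum_pmap (F := fun x => nsq (extend f x))).
  under eq_bigr do rewrite extend_val.
  by apply: hf; apply: pmap_sub_uniq.
by move=> x lx; rewrite extend_out // /nsq /= expr0n addr0.
Qed.

Lemma two_children a : exists c c', [/\ par c = a, par c' = a & c != c'].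
Proof.
have := ch_size a; have := ch_uniq a; have := @mem_ch a.
case: (ch a) => [|c [|c' s]] hm hu hs; try by move: q2; rewrite -hs.
exists c, c'; split.
- by apply/eqP; rewrite -hm inE eqxx.
- by apply/eqP; rewrite -hm !inE eqxx orbT.
- by move: hu; rewrite /= inE negb_or => /andP[/andP[]].
Qed.

Let depth_eq (a b : int) (n : nat) : a - b + 1 = n%:Z + 1 -> `|a - b|%N = n.
Proof. by clear; lia. Qed.

Let third_depth (y1 y2 y3 k1 k2 k3 : int) (n1 n2 n3 N : nat) :
  N%:Z = 3 - (k1 + k2 + k3) -> N%:Z = (n1 + n2 + n3 + 3)%:Z ->
  y1 - k1 + 1 = n1%:Z + 1 -> y2 - k2 + 1 = n2%:Z + 1 -> y1 + y2 + y3 = 0 ->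
  y3 - k3 + 1 = n3%:Z + 1.
Proof. by clear; lia. Qed.

Section Tetrahedron.
Variables (c1 c1' c2 c2' c3 c3' : T).
Hypothesis sib1 : par c1 = par c1'.
Hypothesis sib2 : par c2 = par c2'.
Hypothesis sib3 : par c3 = par c3'.
Variable N : nat.
Hypothesis N0 : (0 < N)%N.
Hypothesis NE : N%:Z = 3 - (h c1 + h c2 + h c3).

Local Notation L k := (cos (angle R N k)).
Local Notation haar3 := (haar3 R par h c1 c1' c2 c2' c3 c3').

Definition psi_tetra (s r : int) (v : DL) : C :=
  tetra par h c1 c1' c2 c2' c3 c3'
    (psi (cis R N) s (s + 3 * r) (- 2 * s - 3 * r)) (val v).

Lemma psi_tetra_eigen s r : P (psi_tetra s r) = fun v =>
  (3^-1 * (L s + L (s + 3 * r) + L (- 2 * s - 3 * r)))%:C%C * psi_tetra s r v.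
Proof.
apply/funext => v; rewrite /psi_tetra (srw_val hT homega).
have t_sum : s + (s + 3 * r) + (- 2 * s - 3 * r) = 0 by ring.
have cD := @cisD R N N0; have c0 := @cis0 R N.
have per a k : cis R N (a + k * (3 * N)%:Z) = cis R N a.
  rewrite cD (_ : cis R N (k * _) = 1) ?mulr1 //.
  by apply/(cis_eq1 R N0); rewrite dvdz_mull.
have wall u w : u + w = 3 - (h c1 + h c2 + h c3) ->
    psi (cis R N) s (s + 3 * r) (- 2 * s - 3 * r) u w = 0.
  move=> uw; apply: (psi_wall c0 cD t_sum _ _ (etrans uw (esym NE))).
    by rewrite -(per (s * N%:Z) r); congr cis; rewrite PoszM; ring.
  by rewrite -(per ((- 2 * s - 3 * r) * N%:Z) (s + 2 * r)); congr cis; rewrite PoszM; ring.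
rewrite (tetra_moves h_par ch_uniq ch_size mem_ch sib1 sib2 sib3 (level_DL v) (psi_u0 _ _ _ _)
  (psi_v0 _ _ _ _) wall) (psi_shift cD t_sum) /tetra.
move: (s + 3 * r) (- 2 * s - 3 * r) => t2 t3.
move: (psi _ _ _ _ _ _) (haar3 _) => ps hs.
have -> : cis R N s + cis R N (- s) + cis R N t2 + cis R N (- t2) + cis R N t3 + cis R N (- t3) =
    (2 * (L s + L t2 + L t3))%:C%C.
  by rewrite -addrA -(addrA (cis R N s + _)) !cis_sum -!rmorphD; congr (_%:C)%C; ring.
have qN : q%:R != 0 :> C by rewrite pnatr_eq0 -lt0n.
rewrite !rmorphM fmorphV !rmorph_nat natrM; field.
by rewrite qN.
Qed.

Lemma psi_tetra_support : exists2 S : seq DL, uniq S &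
  forall v, v \notin S -> haar3 (val v) = 0.
Proof.
have [s hs] := haar3_finite_support R h mem_ch sib1 sib2 sib3.
exists (undup (pmap insub s)); first exact: undup_uniq.
move=> v; rewrite mem_undup mem_pmap_sub => vs; apply/eqP; apply: contraNT vs => hv.
by apply: hs => //; exact: level_DL.
Qed.

Lemma psi_tetra_l2 s r : l2 (psi_tetra s r).
Proof.
have [S uS hS] := psi_tetra_support.
apply: (@bnd_l2 _ _ _ (\sum_(v <- S) nsq (psi_tetra s r v))) => l ul.
have z v : v \notin S -> nsq (psi_tetra s r v) = 0.
  by move=> /hS v0; rewrite /psi_tetra /tetra v0 mul0r /nsq /= expr0n addr0.
have -> : \sum_(v <- l) nsq (psi_tetra s r v) =
    \sum_(v <- [seq v <- l | v \in S]) nsq (psi_tetra s r v).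
  rewrite big_filter [RHS]big_mkcond; apply: eq_bigr => v _.
  by case: ifP => // /negbT /z.
apply: ler_sum_sub; rewrite ?filter_uniq //; last by move=> x; exact: nsq_ge0.
by move=> v; rewrite mem_filter => /andP[].
Qed.

(** By Fourier inversion the restriction of a product of Haar functions to fixed depths is
    a combination of the eigenfunctions [psi_tetra]. These are zero or have eigenvalues
    in the lambda set, so they are orthogonal to [f]. *)
Lemma haar3_sum (f : DL -> C) (n1 n2 n3 : nat) (z : C) :
  N%:Z = (n1 + n2 + n3 + 3)%:Z -> P f = (fun v => z * f v) -> ~ lambda_set R z ->
  \sum_(a <- haar_supp ch n1 c1 c1') \sum_(b <- haar_supp ch n2 c2 c2')
    \sum_(c <- haar_supp ch n3 c3 c3') haar3 (triple a b c) * extend f (triple a b c) = 0.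
Proof.
move=> Nn Pf zL; have [S uS hS] := psi_tetra_support.
have ortho s r : \sum_(v <- S) f v * psi_tetra s r v = 0.
  have supp v : v \notin S -> psi_tetra s r v = 0.
    by move=> /hS v0; rewrite /psi_tetra /tetra v0 mul0r.
  have [deg|reg] := pselect (cis R N s = cis R N (s + 3 * r) \/
      cis R N (s + 3 * r) = cis R N (- 2 * s - 3 * r) \/
      cis R N s = cis R N (- 2 * s - 3 * r)).
    apply: big1 => v _; rewrite /psi_tetra /tetra.
    by rewrite (psi_degenerate (@cis0 R N) (@cisD R N N0) deg) !mulr0.
  apply: (eigenfunctions_orthogonal hT homega _ Pf (psi_tetra_eigen s r) uS supp).
  apply/eqP => zE; apply: zL.
  have [m1 [m2 [m3 [msum mpos mN mE]]]] : exists m1 m2 m3 : int,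
    [/\ m1 + m2 + m3 = 0, (0 < m1) && (0 < m2), - (N%:Z) < m3 &
      3^-1 * (L s + L (s + 3 * r) + L (- 2 * s - 3 * r)) = lambda_mN R m1 m2 m3 N].
    by apply: regular_in_alcove => //; apply/eqP => E; apply: reg; tauto.
  exists m1, m2, m3, N; split=> //; last by rewrite zE mE.
  by move: Nn; clear; lia.
pose u' : int := n1%:Z + 1; pose v' : int := n2%:Z + 1.
pose ind (x : X) : C := ((h (x 0) - h c1 + 1 == u') && (h (x 1) - h c2 + 1 == v'))%:R.
(* the scalar product of f with the product of Haar functions at the depths u', v' *)
have loc : \sum_(v <- S) extend f (val v) * haar3 (val v) * ind (val v) = 0.
  have NN : (3 * N * N)%:R != 0 :> C by rewrite pnatr_eq0; lia.
  apply: (mulIf NN); rewrite mul0r mulr_suml.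
  transitivity (\sum_(v <- S) \sum_(0 <= s < 3 * N) \sum_(0 <= r < N)
     cis R N (- (s%:Z * u') + (- 2 * s%:Z - 3 * r%:Z) * v') * (f v * psi_tetra s%:Z r%:Z v)).
    apply: eq_bigr => v _; rewrite extend_val.
    have [v0|v0] := eqVneq (haar3 (val v)) 0.
      rewrite v0 mulr0 !mul0r; apply/esym; apply: big1 => s _; apply: big1 => r _.
      by rewrite /psi_tetra /tetra v0 mul0r !mulr0.
    have [p1 p2 p3] : [/\ h c1 <= h (val v 0), h c2 <= h (val v 1) & h c3 <= h (val v 2)].
      move: v0; rewrite /haar3 !mulf_eq0 !negb_or => /andP[/andP[x1 x2] x3].
      by split; rewrite leNgt; apply/negP => lt;
        [move: x1|move: x2|move: x3]; rewrite haar_above ?eqxx.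
    have lv : h (val v 0) + h (val v 1) + h (val v 2) = 0.
      by rewrite -(level_triple h) -tripleE level_DL.
    rewrite /ind /psi_tetra /tetra.
    move: (h (val v 0)) (h (val v 1)) (h (val v 2)) p1 p2 p3 lv => x1 x2 x3 p1 p2 p3 lv.
    have k1 : 0 < x1 - h c1 + 1 by clear -p1; lia.
    have k2 : 0 < x2 - h c2 + 1 by clear -p2; lia.
    have k3 : x1 - h c1 + 1 + (x2 - h c2 + 1) < N%:Z by rewrite NE; clear -p3 lv; lia.
    have k4 : u' + v' < N%:Z by rewrite /u' /v'; clear -Nn; lia.
    have k5 : 0 < u' by rewrite /u'; clear; lia.
    have k6 : 0 < v' by rewrite /v'; clear; lia.
    rewrite -(mulrA (f v * _)) -(@fourier_inversion _ (cis R N) N (@cis0 R N) (@cisD R N N0)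
      N0 (cis_eq1 R N0) _ _ u' v' k1 k2 k3 k5 k6 k4).
    rewrite mulr_sumr; apply: eq_bigr => s _; rewrite mulr_sumr; apply: eq_bigr => r _.
    ring.
  rewrite exchange_big big1 // => s _; rewrite exchange_big big1 // => r _.
  by rewrite -mulr_sumr ortho mulr0.
pose Y := [seq triple p.1 p.2 c | p <- [seq (a, b) | a <- haar_supp ch n1 c1 c1',
   b <- haar_supp ch n2 c2 c2'], c <- haar_supp ch n3 c3 c3'].
have uY : uniq Y.
  apply: allpairs_uniq; rewrite ?undup_uniq //.
    by apply: allpairs_uniq; rewrite ?undup_uniq // => -[? ?] [? ?].
  by move=> [[a b] c] [[a' b'] c'] _ _ /= /triple_inj[-> -> ->].
have hY n c c' y : par c = par c' -> y \in haar_supp ch n c c' -> h y = h c + n%:Z.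
  move=> cc'; rewrite mem_undup mem_cat !(mem_desc mem_ch) => hy.
  have := iter_height h_par n y; have := sibling_height h_par cc'.
  by case/orP: hy => /eqP ->; lia.
pose Psi x := extend f x * haar3 x * ind x.
have PsiY : \sum_(x <- Y) Psi x = 0.
  rewrite (sum_pmap (F := Psi)) => [|x lx]; last by rewrite /Psi extend_out ?mul0r.
  apply: etrans loc; apply: (@sum_support R DL (pmap insub Y) S (fun v => Psi (val v))) => //.
    exact: pmap_sub_uniq.
    move=> v; rewrite mem_pmap_sub => vY; rewrite /Psi.
    have [v0|v0] := eqVneq (haar3 (val v)) 0; first by rewrite v0 mulr0 mul0r.
    rewrite /ind; case: andP => [[/eqP i1 /eqP i2]|_]; last by rewrite mulr0.
    case/negP: vY; rewrite (tripleE (val v)).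
    have lv : h (val v 0) + h (val v 1) + h (val v 2) = 0.
      by rewrite -(level_triple h) -tripleE level_DL.
    move: v0; rewrite /haar3 !mulf_eq0 !negb_or => /andP[/andP[x1 x2] x3].
    have [d1 s1] := haar_in_supp mem_ch sib1 x1.
    have [d2 s2] := haar_in_supp mem_ch sib2 x2.
    have [d3 s3] := haar_in_supp mem_ch sib3 x3.
    have E1 := depth_eq i1; have E2 := depth_eq i2.
    have E3 := depth_eq (third_depth NE Nn i1 i2 lv).
    rewrite {}E1 in s1; rewrite {}E2 in s2; rewrite {}E3 in s3.
    apply/allpairsP; exists ((val v 0, val v 1), val v 2); split=> //=.
    by apply/allpairsP; exists (val v 0, val v 1).
  by move=> v /hS v0; rewrite /Psi v0 mulr0 mul0r.
rewrite -[RHS]PsiY /Y big_allpairs_dep /= big_allpairs_dep /=.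
rewrite big_seq [RHS]big_seq; apply: eq_bigr => a /(hY _ _ _ _ sib1) ha.
rewrite big_seq [RHS]big_seq; apply: eq_bigr => b /(hY _ _ _ _ sib2) hb.
apply: eq_bigr => c _; rewrite /Psi /ind.
rewrite !ffunE /= ha hb (_ : _ && _ = true) ?mulr1 1?mulrC //.
by rewrite /u' /v'; apply/andP; split; apply/eqP; lia.
Qed.

End Tetrahedron.

(** Otherwise all coefficients of the eigenfunction in the tensor Haar system vanish. *)
Lemma eigenvalues_sub_lambda z : eigenvalues P z -> lambda_set R z.
Proof.
move=> [f [lf f0 Pf]]; apply: contrapT => zL; apply: f0.
have bX := bnd_extend (bnd_l2norm lf).
have slice (m : T -> X) : injective m ->
    bnd (fun a => extend f (m a)) (l2norm f ^+ 2).
  move=> im s us; have := bX (map m s); rewrite big_map; apply.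
  by rewrite map_inj_uniq.
suff G0 a b c : extend f (triple a b c) = 0.
  by apply/funext => v; rewrite -extend_val (tripleE (val v)).
apply: (haar_complete3 h_par ch_uniq ch_size mem_ch q2
  (G := fun a b c => extend f (triple a b c)) (K := l2norm f ^+ 2)).
- by move=> b' c'; apply: slice => x y /triple_inj[].
- by move=> a' c'; apply: slice => x y /triple_inj[].
- by move=> a' b'; apply: slice => x y /triple_inj[].
move=> n1 c1 c1' n2 c2 c2' n3 c3 c3' s1 s2 s3.
have [lv|lv] := eqVneq (h c1 + h c2 + h c3 + (n1 + n2 + n3)%:Z) 0; last first.
  have hY n k k' y : par k = par k' -> y \in haar_supp ch n k k' -> h y = h k + n%:Z.
    move=> kk'; rewrite mem_undup mem_cat !(mem_desc mem_ch) => hy.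
    have := iter_height h_par n y; have := sibling_height h_par kk'.
    by case/orP: hy => /eqP ->; lia.
  rewrite big_seq big1 // => x /(hY _ _ _ _ s1) hx.
  rewrite big_seq big1 // => y /(hY _ _ _ _ s2) hy.
  rewrite big_seq big1 // => w /(hY _ _ _ _ s3) hw.
  rewrite extend_out ?mulr0 // level_triple hx hy hw.
  move: lv; apply: contra_neq; clear; lia.
have NE : (n1 + n2 + n3 + 3)%:Z = 3 - (h c1 + h c2 + h c3).
  by move: (h c1 + h c2 + h c3) lv => S; clear; lia.
have N0 : (0 < n1 + n2 + n3 + 3)%N by clear; lia.
rewrite -[RHS](haar3_sum s1 s2 s3 N0 NE (n1 := n1) (n2 := n2) (n3 := n3) erefl Pf zL).
apply: eq_bigr => x _; apply: eq_bigr => y _; apply: eq_bigr => w _.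
by rewrite /haar3 !ffunE.
Qed.

(** The tetrahedron with vertices at heights [- N], 0 and 0 carries [psi_tetra]; at the
    depths 1, 1, [N - 2] it takes the Vandermonde value [psi 1 1]. *)
Lemma lambda_sub_eigenvalues z : lambda_set R z -> eigenvalues P z.
Proof.
move=> [m1 [m2 [m3 [N [N2 msum /andP[m1p m2p] m3N ->]]]]].
have N0 : (0 < N)%N by exact: ltnW.
have m12 : m1 + m2 < N%:Z by move: msum m3N; clear; lia.
have [c1 [c1' [e1 e1' n1]]] := two_children (iter N par o).
have [c2 [c2' [e2 e2' n2]]] := two_children o.
have [c3 [c3' [e3 e3' n3]]] := two_children o.
have s1 : par c1 = par c1' by rewrite e1 e1'.
have s2 : par c2 = par c2' by rewrite e2 e2'.
have s3 : par c3 = par c3' by rewrite e3 e3'.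
have ho : h o = 0 := busemann_root hT homega o.
have h1 : h c1 = 1 - N%:Z.
  by have := h_par c1; rewrite e1 (iter_height h_par) ho; clear; lia.
have h2 : h c2 = 1 by have := h_par c2; rewrite e2 ho; clear; lia.
have h3 : h c3 = 1 by have := h_par c3; rewrite e3 ho; clear; lia.
have NE : N%:Z = 3 - (h c1 + h c2 + h c3) by rewrite h1 h2 h3; clear; lia.
exists (psi_tetra c1 c1' c2 c2' c3 c3' N (m1 - m2) m2); split.
- exact: psi_tetra_l2.
- have [k kN] : exists k, N = k.+3.
    by exists (N - 3)%N; move: m1p m2p m12; clear; lia.
  have [x3 hx3] : exists x3, x3 \in desc ch k c3.
    have := desc_size ch_size k c3; case: (desc ch k c3) => [|x s] /=.
      by move/esym/eqP; rewrite expn_eq0 -leqn0 leqNgt q0.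
    by exists x; rewrite inE eqxx.
  have hx : h x3 = 1 + k%:Z.
    move: hx3; rewrite (mem_desc mem_ch) => /eqP E.
    by have := iter_height h_par k x3; rewrite E h3; clear; lia.
  have lx : level h (triple c1 c2 x3) == 0.
    by rewrite level_triple h1 h2 hx kN; apply/eqP; clear; lia.
  pose v : DL := exist _ (triple c1 c2 x3) lx.
  move=> /(congr1 (fun F => F v)) /eqP; apply/negP.
  have self c c' : c != c' -> haar R par h c c' c = 1.
    move=> cc'; rewrite (haar_desc R mem_ch c' (n := 0)) ?addr0 //.
    by rewrite !inE eqxx (negbTE cc') subr0.
  rewrite /psi_tetra /tetra /haar3 !ffunE /= (self c1 c1') // (self c2 c2') //.
  rewrite (haar_desc R mem_ch c3' (n := k)); last by rewrite hx h3.
  rewrite hx3; move: hx3; rewrite !(mem_desc mem_ch) => /eqP ->.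
  rewrite (negbTE n3) subr0 !mul1r !subrr !add0r.
  have cN a b : 0 < a - b -> a - b < (3 * N)%:Z -> cis R N a != cis R N b.
    move=> ab0 abN; apply/eqP => E; have : cis R N (a - b) = 1.
      by rewrite (@cisD R N N0) E -(@cisD R N N0) subrr cis0.
    move=> /(cis_eq1 R N0)/dvdzP[w wE]; move: ab0 abN; rewrite wE.
    by have [w0|w0] := leP w 0; move: w0 N0; clear; nia.
  have m12p : 0 < m1 + m2 by rewrite addr_gt0.
  apply: (psi_11 (@cis0 R N) (@cisD R N N0)).
  + by clear; ring.
  + by rewrite eq_sym; apply: cN; move: m1p m2p m12; clear; lia.
  + by apply: cN; move: m1p m2p m12; clear; lia.
  + by apply: cN; move: m1p m2p m12; clear; lia.
- rewrite psi_tetra_eigen //; apply/funext => v; congr (_%:C%C * _).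
  have m3E : m3 = - m1 - m2 by move: msum; clear; lia.
  rewrite /lambda_mN m3E /angle.
  rewrite (_ : m1 - m2 + 3 * m2 = m2 - (- m1 - m2)); last by ring.
  by rewrite (_ : - 2 * (m1 - m2) - 3 * m2 = - m1 - m2 - m1) //; ring.
Qed.

End PointSpectrum.

Theorem mainTheorem13 (R : realType) (q : nat) (hq : (2 <= q)%N)
    (T : choiceType) (e : rel T) (hT : homogeneous_tree e q)
    (o : T) (omega : set (nat -> T)) (homega : is_end e omega) :
  let P := @srw T e omega o R q in
  [/\ spectrum P = [set x%:C%C | x in `[- 2^-1, 1]],
      eigenvalues P = lambda_set R &
      spectrum P = closure (lambda_set R : set R[i]^o)].
Proof.
move=> P.
have eigE : eigenvalues P = lambda_set R.
  apply/seteqP; split=> z; first exact: eigenvalues_sub_lambda.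
  exact: lambda_sub_eigenvalues.
have approx (z : R[i]) : (forall eps : R, 0 < eps ->
    exists2 w, lambda_set R w & nsq (w - z) < eps) -> spectrum P z.
  by move=> h; apply: approximate_eigenvalue; rewrite eigE.
have sub z : spectrum P z -> [set x%:C%C | x in `[- 2^-1, 1]] z.
  exact: (srw_spectrum_subset hT homega (ltnW hq)).
have dense (z : R[i]) : [set x%:C%C | x in `[- 2^-1, 1]] z -> forall eps : R, 0 < eps ->
    exists2 w, lambda_set R w & nsq (w - z) < eps.
  move=> [x /=]; rewrite in_itv /= => xI <- eps e0.
  exact: lambda_set_dense.
have specE : spectrum P = [set x%:C%C | x in `[- 2^-1, 1]].
  by apply/seteqP; split=> z; [exact: sub | move=> /dense; exact: approx].
have norm_lt (z w r : R[i]) : 0 < r -> (`|z - w| < r) = (nsq (w - z) < complex.Re r ^+ 2).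
  move=> rp; have [im re] : complex.Im r = 0 /\ 0 < complex.Re r.
    by move: rp; rewrite ltcE /= => /andP[/eqP -> ->].
  rewrite distrC normc_def ltcE /= im eqxx /=.
  rewrite -[in RHS](sqr_sqrtr (nsq_ge0 (w - z))) ltr_pXn2r ?nnegrE ?sqrtr_ge0 //.
  exact: ltW re.
split=> //; apply/seteqP; split=> z.
  rewrite specE => /dense h B /nbhs_ballP[r /= rp rB].
  have re : 0 < complex.Re r by move: rp; rewrite ltcE /= => /andP[].
  have [w wL wz] := h (complex.Re r ^+ 2) (exprn_gt0 2 re).
  by exists w; split=> //; apply: rB; rewrite -ball_normE /= norm_lt.
move=> h; apply: approx => eps e0.
have r0 : 0 < (Num.sqrt eps)%:C%C :> R[i] by rewrite ltcR sqrtr_gt0.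
have [w [wL]] := h _ (nbhsx_ballx (z : R[i]^o) _ r0).
rewrite -ball_normE /= norm_lt //= sqr_sqrtr ?(ltW e0) // => wz.
by exists w.
Qed.
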